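(* Let $\alpha>0$, $0<p<\infty$, and let $\psi$ and $u$ be entire functions on $\mathbb{C}$. Then the following statements are equivalent: (i) $uC_\psi:\mathcal{F}_\alpha^\infty\to\mathcal{F}_\alpha^p$ is bounded; (ii) $uC_\psi:\mathcal{F}_\alpha^\infty\to\mathcal{F}_\alpha^p$ is compact; (iii) $\displaystyle\int_{\mathbb{C}}\int_{\mathbb{C}}|k_{(w,\alpha)}(\psi(z))u(z)|^pe^{-\frac{p\alpha}{2}|z|^2}\,dm(z)\,dm(w)<\infty$. Moreover, if $uC_\psi$ is bounded, then $$\|uC_\psi\|^p\simeq\int_{\mathbb{C}}\int_{\mathbb{C}}|k_{(w,\alpha)}(\psi(z))u(z)|^pe^{-\frac{p\alpha}{2}|z|^2}\,dm(z)\,dm(w)<\infty.$$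
   Context: $dm$ is Lebesgue measure on $\mathbb{C}$. For $\alpha>0$ and $0<p<\infty$, the Fock space $\mathcal{F}_\alpha^p$ consists of the entire functions $f$ with $\|f\|_{(p,\alpha)}^p=\frac{\alpha p}{2\pi}\int_{\mathbb{C}}|f(z)|^pe^{-\frac{\alpha p}{2}|z|^2}dm(z)<\infty$; $\mathcal{F}_\alpha^\infty$ consists of the entire functions $f$ with $\|f\|_{(\infty,\alpha)}=\sup_{z\in\mathbb{C}}|f(z)|e^{-\frac{\alpha}{2}|z|^2}<\infty$. The weighted composition operator is $(uC_\psi)f(z)=u(z)f(\psi(z))$. Let $k_{(w,\alpha)}(z)=e^{\alpha\langle z,w\rangle-\alpha|w|^2/2}$ with $\langle z,w\rangle=z\overline{w}$. $\|T\|$ is the operator norm $\sup\{\|Tf\|:\|f\|\le1\}$. $U\simeq V$ means $C^{-1}V\le U\le CV$ for a constant $C>0$ depending only on $p$ and $\alpha$ (not on $u,\psi$). *)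

(* Defs.v *)
From HB Require Import structures.
From mathcomp Require Import all_boot all_order all_algebra.
From mathcomp Require Import complex.
From mathcomp Require Import all_classical all_reals all_analysis.

Set Implicit Arguments.
Unset Strict Implicit.
Unset Printing Implicit Defensive.

Import Order.TTheory GRing.Theory Num.Theory.
Import numFieldNormedType.Exports.

Local Open Scope classical_set_scope.
Local Open Scope ring_scope.
Local Open Scope complex_scope.

(* The norm of R[i] takes its values in R[i]; this is the real modulus. *)
Definition cabs (R : realType) (z : R[i]) : R := complex.Re `|z|.

Definition cexp (R : realType) (z : R[i]) : R[i] :=
  (expR (complex.Re z))%:C *
  (cos (complex.Im z) +i* sin (complex.Im z)).

(* The regular module R[i]^o carries the normed structure of R[i] over itself,
   so this is differentiability in the complex sense. *)
Definition entire (R : realType) (f : R[i] -> R[i]) : Prop :=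
  forall z : R[i], derivable (f : R[i]^o -> R[i]^o) z 1.

(* Integral with respect to Lebesgue measure dm(z) on the complex plane, which
   is identified with R * R. *)
Definition cintegral (R : realType) (F : R[i] -> \bar R) : \bar R :=
  (\int[(@lebesgue_measure R) \x (@lebesgue_measure R)]_xy
     F (xy.1 +i* xy.2))%E.

(* Exponents p range over ]0, +oo]; the value at -oo is irrelevant. *)
Definition fock_norm (R : realType) (alpha : R) (p : \bar R)
    (f : R[i] -> R[i]) : \bar R :=
  match p with
  | r%:E => (((alpha * r / (2 * pi))%:E *
              cintegral (fun z =>
                (cabs (f z) `^ r *
                 expR (- (alpha * r / 2) * cabs z ^+ 2))%:E)) `^ r^-1)%E
  | +oo%E => ereal_sup
              [set (cabs (f z) * expR (- (alpha / 2) * cabs z ^+ 2))%:E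
              | z in [set: R[i]]]
  | -oo%E => 0%E
  end.

Definition fock (R : realType) (alpha : R) (p : \bar R) :
    set (R[i] -> R[i]) :=
  [set f | entire f /\ (fock_norm alpha p f < +oo)%E].

Definition wcomp (R : realType) (u psi : R[i] -> R[i])
    (f : R[i] -> R[i]) : R[i] -> R[i] :=
  fun z => u z * f (psi z).

Definition fock_kernel (R : realType) (alpha : R) (w z : R[i]) : R[i] :=
  cexp (alpha%:C * (z * w^*) - (alpha * cabs w ^+ 2 / 2)%:C).

Definition fock_bounded (R : realType) (alpha : R) (p q : \bar R)
    (T : (R[i] -> R[i]) -> (R[i] -> R[i])) : Prop :=
  (forall f, fock alpha p f -> fock alpha q (T f)) /\
  exists M : R, forall f, fock alpha p f ->
    (fock_norm alpha q (T f) <= M%:E * fock_norm alpha p f)%E.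

(* For q < 1 the target is only quasi-normed, but it is still metrizable, so
   compactness is expressed with bounded sequences for all q. *)
Definition fock_compact (R : realType) (alpha : R) (p q : \bar R)
    (T : (R[i] -> R[i]) -> (R[i] -> R[i])) : Prop :=
  (forall f, fock alpha p f -> fock alpha q (T f)) /\
  forall f_ : nat -> R[i] -> R[i],
    (forall n, fock alpha p (f_ n)) ->
    (exists M : R, forall n, (fock_norm alpha p (f_ n) <= M%:E)%E) ->
    exists (phi : nat -> nat) (g : R[i] -> R[i]),
      [/\ {homo phi : m n / (m < n)%N}, fock alpha q g &
          (fun n => fock_norm alpha q (fun z => T (f_ (phi n)) z - g z))
            @ \oo --> 0%E].

Definition fock_opnorm (R : realType) (alpha : R) (p q : \bar R)
    (T : (R[i] -> R[i]) -> (R[i] -> R[i])) : \bar R :=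
  ereal_sup [set fock_norm alpha q (T f) | f in
    [set f | fock alpha p f /\ (fock_norm alpha p f <= 1)%E]].

Definition kernel_integral (R : realType) (alpha p : R)
    (u psi : R[i] -> R[i]) : \bar R :=
  cintegral (fun w => cintegral (fun z =>
    (cabs (fock_kernel alpha w (psi z) * u z) `^ p *
     expR (- (p * alpha / 2) * cabs z ^+ 2))%:E)).

(* Main.v *)
Require Import Defs.
From HB Require Import structures.
From mathcomp Require Import all_boot all_order all_algebra.
From mathcomp Require Import complex.
From mathcomp Require Import all_classical all_reals all_analysis.
From mathcomp Require Import measurable_realfun.
From mathcomp Require Import ring lra.

Set Implicit Arguments.
Unset Strict Implicit.
Unset Printing Implicit Defensive.

Import Order.TTheory GRing.Theory Num.Theory.
Import numFieldNormedType.Exports.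

Local Open Scope classical_set_scope.
Local Open Scope ring_scope.
Local Open Scope complex_scope.

(** Why the theorem is true.  Tonelli's theorem, with the integral in [w] taken
    first, leaves a Gaussian integral which does not depend on [psi z], so the
    double integral of the kernels is a constant multiple of
    [J = int |u|^p exp ((p alpha / 2) (|psi|^2 - |z|^2)) dm]
    ([kernel_integralE]).  Everything is then compared with [J].

    A function of the unit ball of the Fock space of exponent infinity satisfies
    [|f (psi z)| <= exp ((alpha / 2) |psi z|^2)], so the operator norm to the
    power [p] is at most a constant times [J] ([opnorm_pow_le]), and [uC_psi] is
    bounded when [J] is finite.

    Conversely ([symbol_integral_le_opnorm]), the waves
    [exp (alpha z^2 / 2 - 2 i alpha s z - alpha s^2)], with [s] an integer, have
    modulus [exp ((alpha / 2) |z|^2) exp (- alpha (Im z - s)^2)].  Their finite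
    sums with arbitrary signs lie in a fixed ball of the space of exponent
    infinity, whereas near each point of a horizontal strip one of the waves is
    comparable to [exp ((alpha / 2) |z|^2)].  Averaging over the signs
    ([random_signs]) and letting the strip grow bounds [J] by a constant times
    the operator norm to the power [p].  A compact operator has finite norm
    ([compact_opnorm]), so both boundedness and compactness make [J] finite.

    Compactness when [J] is finite ([compact_of_integral]) is dominated
    convergence along the subsequence given by Montel's theorem ([montel]).
    Since entire functions are only assumed to be differentiable at each point,
    Montel's theorem rests on Goursat's theorem for rectangles
    ([goursat_rectangle]), which through the exponential map gives Cauchy's
    estimate for the derivative ([cauchy_estimate]).  This yields local
    Lipschitz bounds for the functions and their derivatives, hence a uniform
    second order estimate that survives pointwise limits. *)

(** * Modulus and complex derivative *)

Section Modulus.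
Variable R : realType.
Implicit Types z w : R[i].

Lemma normC_cabs z : `|z| = (cabs z)%:C.
Proof. by rewrite /cabs normc_def. Qed.

Lemma cabsE z : cabs z = Num.sqrt (complex.Re z ^+ 2 + complex.Im z ^+ 2).
Proof. by rewrite /cabs normc_def. Qed.

Lemma cabs_ge0 z : 0 <= cabs z.
Proof. by rewrite cabsE sqrtr_ge0. Qed.

Lemma sqr_cabs z : cabs z ^+ 2 = complex.Re z ^+ 2 + complex.Im z ^+ 2.
Proof. by rewrite cabsE sqr_sqrtr// addr_ge0 ?sqr_ge0. Qed.

Lemma cabsM z w : cabs (z * w) = cabs z * cabs w.
Proof. by apply: complexI; rewrite rmorphM/= -!normC_cabs normrM. Qed.

Lemma cabsD z w : cabs (z + w) <= cabs z + cabs w.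
Proof. by rewrite -lecR rmorphD/= -!normC_cabs ler_normD. Qed.

Lemma cabsN z : cabs (- z) = cabs z.
Proof. by rewrite /cabs normrN. Qed.

Lemma cabsB z w : cabs (z - w) <= cabs z + cabs w.
Proof. by rewrite -(cabsN w) cabsD. Qed.

Lemma cabsC z w : cabs (z - w) = cabs (w - z).
Proof. by rewrite /cabs distrC. Qed.

Lemma cabs0 : cabs (0 : R[i]) = 0.
Proof. by rewrite /cabs normr0. Qed.

Lemma cabs1 : cabs (1 : R[i]) = 1.
Proof. by rewrite /cabs normr1. Qed.

Lemma cabs_eq0 z : (cabs z == 0) = (z == 0).
Proof. by rewrite -(inj_eq (@complexI R)) -normC_cabs normr_eq0. Qed.

Lemma cabs_gt0 z : (0 < cabs z) = (z != 0).
Proof. by rewrite lt_def cabs_ge0 andbT cabs_eq0. Qed.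

Lemma cabsV z : cabs z^-1 = (cabs z)^-1.
Proof. by apply: complexI; rewrite fmorphV/= -!normC_cabs normfV. Qed.

Lemma cabs_real (x : R) : cabs x%:C = `|x|.
Proof. by rewrite cabsE/= expr0n addr0 sqrtr_sqr. Qed.

Lemma Re_le_cabs z : `|complex.Re z| <= cabs z.
Proof. by rewrite -lecR -normC_cabs normc_ge_Re. Qed.

Lemma Im_le_cabs z : `|complex.Im z| <= cabs z.
Proof.
by rewrite cabsE -[leLHS]sqrtr_sqr ler_sqrt ?lerDr ?addr_ge0 ?sqr_ge0.
Qed.

Lemma cabs_le_ReIm z : cabs z <= `|complex.Re z| + `|complex.Im z|.
Proof.
rewrite -(@ler_pXn2r _ 2) ?nnegrE ?addr_ge0 ?cabs_ge0//.
rewrite sqr_cabs sqrrD !real_normK ?num_real// lerD2r lerDl.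
by rewrite mulrn_wge0 // mulr_ge0.
Qed.

Lemma ReM z w : complex.Re (z * w) =
  complex.Re z * complex.Re w - complex.Im z * complex.Im w.
Proof. by case: z w => a b [c d]. Qed.

Lemma ImM z w : complex.Im (z * w) =
  complex.Re z * complex.Im w + complex.Im z * complex.Re w.
Proof. by case: z w => a b [c d]. Qed.

Lemma ReD z w : complex.Re (z + w) = complex.Re z + complex.Re w.
Proof. by case: z w => a b [c d]. Qed.

Lemma ImD z w : complex.Im (z + w) = complex.Im z + complex.Im w.
Proof. by case: z w => a b [c d]. Qed.

Lemma ReN z : complex.Re (- z) = - complex.Re z.
Proof. by case: z. Qed.

Lemma ImN z : complex.Im (- z) = - complex.Im z.
Proof. by case: z. Qed.

Lemma cabs_pair_le (x y : R) : cabs (x +i* y) <= `|x| + `|y|.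
Proof. exact: (cabs_le_ReIm (x +i* y)). Qed.

Lemma cabs_sum (I : Type) (s : seq I) (F : I -> R[i]) :
  cabs (\sum_(i <- s) F i) <= \sum_(i <- s) cabs (F i).
Proof.
elim: s => [|i s IH]; first by rewrite !big_nil cabs0.
by rewrite !big_cons (le_trans (cabsD _ _))// lerD2l.
Qed.

End Modulus.

(** [cdiff f z d] says that [d] is the complex derivative of [f] at [z], with
    real epsilons. *)
Definition cdiff (R : realType) (f : R[i] -> R[i]) (z d : R[i]) : Prop :=
  forall e : R, 0 < e -> exists2 r : R, 0 < r &
    forall h, cabs h < r -> cabs (f (z + h) - f z - d * h) <= e * cabs h.

Section Derivative.
Variable R : realType.
Implicit Types (f g : R[i] -> R[i]) (z w d : R[i]).

Lemma cdiff_cvg f z d : cdiff f z d <->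
  (h^-1 * (f (h + z) - f z) : R[i]^o) @[h --> (0:R[i]^o)^'] --> (d : R[i]^o).
Proof.
split.
- move=> H; apply/cvgrPdist_le => /= e; case: e => er ei.
  rewrite ltcE/= => /andP[/eqP -> e0].
  have [r r0 Hr] := H _ e0.
  near=> h.
  have hn0 : h != 0 by near: h; exact: (@nbhs_dnbhs_neq R[i]^o).
  have hr : cabs h < r.
    rewrite -ltcR -normC_cabs; near: h.
    apply: (@dnbhs0_lt R[i] R[i]^o r%:C).
    by rewrite ltcE/= eqxx.
  have := Hr h hr.
  rewrite normC_cabs (_ : _ +i* _ = er%:C) // lecR.
  have -> : cabs (d - h^-1 * (f (h + z) - f z)) =
     (cabs h)^-1 * cabs (f (z + h) - f z - d * h).
    by rewrite -cabsV -cabsM -cabsN (addrC z); congr (cabs _); field.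
  by rewrite ler_pdivrMl ?cabs_gt0// (mulrC (cabs h)).
- move=> /cvgrPdist_le H e e0.
  have ec : 0 < e%:C :> R[i] by rewrite ltcE/= eqxx.
  have := H _ ec.
  move=> -[[r ri] /=]; rewrite ltcE/= => /andP[/eqP -> r0] Hr.
  exists r => // h hr.
  have [->|hn0] := eqVneq h 0.
    by rewrite addr0 mulr0 subr0 subrr cabs0 mulr0.
  have := Hr h; rewrite /ball_ /= sub0r normrN normC_cabs.
  rewrite (_ : _ +i* _ = r%:C)// ltcR => /(_ hr hn0).
  rewrite normC_cabs lecR.
  have -> : cabs (d - h^-1 * (f (h + z) - f z)) =
     (cabs h)^-1 * cabs (f (z + h) - f z - d * h).
    by rewrite -cabsV -cabsM -cabsN (addrC z); congr (cabs _); field.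
  by rewrite ler_pdivrMl ?cabs_gt0// (mulrC (cabs h)).
Unshelve. all: by end_near. Qed.

Lemma entireP f : entire f <-> forall z, exists d, cdiff f z d.
Proof.
have E z : (fun h : R[i]^o => h^-1 *: (((f : R[i]^o -> R[i]^o) \o shift z)
    (h *: (1 : R[i]^o)) - f z) : R[i]^o) = (fun h => h^-1 * (f (h + z) - f z)).
  by apply/funext => h; rewrite /= {2}/GRing.scale/= mulr1.
split=> H z.
- exists (lim ((h^-1 * (f (h + z) - f z) : R[i]^o) @[h --> (0:R[i]^o)^'])).
  by apply/cdiff_cvg; have := H z; rewrite /derivable E.
- have [d /cdiff_cvg Hd] := H z.
  by apply/cvg_ex; exists d; rewrite E.
Qed.

Lemma entire_cst (c : R[i]) : entire (fun=> c).
Proof. by move=> z; exact: derivable_cst. Qed.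

Lemma entire_id : entire (@id R[i]).
Proof. by move=> z; exact: derivable_id. Qed.

Lemma entireD f g : entire f -> entire g -> entire (fun z => f z + g z).
Proof. by move=> hf hg z; exact: derivableD. Qed.

Lemma entireB f g : entire f -> entire g -> entire (fun z => f z - g z).
Proof. by move=> hf hg z; exact: derivableB. Qed.

Lemma entireM f g : entire f -> entire g -> entire (fun z => f z * g z).
Proof. by move=> hf hg z; exact: derivableM. Qed.

Lemma entire_comp f g : entire f -> entire g -> entire (fun z => f (g z)).
Proof.
move=> hf hg z.
apply/(@derivable1_diffP R[i] R[i]^o (f \o g)).
apply: (@differentiable_comp R[i] R[i]^o R[i]^o R[i]^o g f).
  by apply/(@derivable1_diffP R[i] R[i]^o).
by apply/(@derivable1_diffP R[i] R[i]^o).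
Qed.

Lemma entire_sum (I : Type) (s : seq I) (F : I -> R[i] -> R[i]) :
  (forall i, entire (F i)) -> entire (fun z => \sum_(i <- s) F i z).
Proof.
move=> H; elim: s => [|i s IH].
  have -> : (fun z => \sum_(i <- [::]) F i z) = (fun=> 0).
    by apply/funext => z; rewrite big_nil.
  exact: (@entire_cst 0).
have -> : (fun z => \sum_(j <- i :: s) F j z) =
    (fun z => F i z + \sum_(j <- s) F j z).
  by apply/funext => z; rewrite big_cons.
exact: (@entireD (F i) _ (H i) IH).
Qed.

Lemma entireZ (c : R[i]) f : entire f -> entire (fun z => c * f z).
Proof. exact: (@entireM (fun=> c) f (@entire_cst c)). Qed.

Lemma cdiff_continuous f z d : cdiff f z d ->
  forall e : R, 0 < e -> exists2 r : R, 0 < r &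
    forall h, cabs h < r -> cabs (f (z + h) - f z) < e.
Proof.
move=> H e e0; have [r r0 Hr] := H 1 ltr01.
have D : 0 < 1 + cabs d by rewrite ltr_wpDr ?cabs_ge0.
exists (Num.min r (e / (1 + cabs d))) => [|h]; first by rewrite lt_min r0 divr_gt0.
rewrite lt_min => /andP[hr he].
have := Hr _ hr; rewrite mul1r => H1.
have -> : f (z + h) - f z = (f (z + h) - f z - d * h) + d * h by ring.
rewrite (le_lt_trans (cabsD _ _))// cabsM.
apply: (@le_lt_trans _ _ ((1 + cabs d) * cabs h)).
  by rewrite mulrDl mul1r lerD2r.
by rewrite mulrC -ltr_pdivlMr.
Qed.

End Derivative.

Arguments entire_cst {R} c z.
Arguments entire_id {R} z.
Arguments entireD {R f g} ef eg z : rename.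
Arguments entireB {R f g} ef eg z : rename.
Arguments entireM {R f g} ef eg z : rename.
Arguments entireZ {R} c {f} ef z : rename.
Arguments entire_comp {R f g} ef eg z : rename.

(** * The complex exponential *)

Section Exponential.
Variable R : realType.
Implicit Types z w : R[i].

Lemma is_derive_epsilon (f : R -> R) (a d : R) : is_derive a 1 f d ->
  forall e : R, 0 < e -> exists2 r : R, 0 < r &
    forall h, `|h| < r -> `|f (a + h) - f a - d * h| <= e * `|h|.
Proof.
move=> [/= df <-] e e0.
have := df; rewrite /derivable => /cvgrPdist_le/= /(_ _ e0) [r /= r0 Hr].
exists r => // h hr.
have [->|hn0] := eqVneq h 0.
  by rewrite addr0 mulr0 subr0 subrr normr0 mulr0.
have := Hr h; rewrite /ball_ /= sub0r normrN => /(_ hr hn0).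
rewrite -/('D_1 f a) /GRing.scale/= mulr1 => Hd.
have -> : f (a + h) - f a - 'D_1 f a * h =
  - h * ('D_1 f a - h^-1 * (f (h + a) - f a)) by rewrite (addrC a); field.
by rewrite normrM normrN mulrC ler_wpM2r.
Qed.

Lemma cexpD z w : cexp (z + w) = cexp z * cexp w.
Proof.
case: z w => a b [c d]; rewrite /cexp /= expRD cosD sinD.
by simpc; congr (_ +i* _); ring.
Qed.

Lemma Re_cexp z : complex.Re (cexp z) = expR (complex.Re z) * cos (complex.Im z).
Proof. by rewrite /cexp ReM/= mul0r subr0. Qed.

Lemma Im_cexp z : complex.Im (cexp z) = expR (complex.Re z) * sin (complex.Im z).
Proof. by rewrite /cexp ImM/= mul0r addr0. Qed.

Lemma cexp0 : cexp (0 : R[i]) = 1.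
Proof.
by apply/eqP; rewrite eq_complex Re_cexp Im_cexp/= expR0 cos0 sin0 mulr1 mulr0 !eqxx.
Qed.

Lemma cabs_cexp z : cabs (cexp z) = expR (complex.Re z).
Proof.
rewrite cabsE Re_cexp Im_cexp !exprMn -mulrDr cos2Dsin2 mulr1 sqrtr_sqr.
by rewrite ger0_norm ?expR_ge0.
Qed.

Lemma cexp_periodic (x y : R) : cexp (x +i* (y + 2 * pi)) = cexp (x +i* y).
Proof.
apply/eqP; rewrite eq_complex !Re_cexp !Im_cexp/=.
by rewrite mulr_natl cosD2pi sinD2pi !eqxx.
Qed.

Lemma cdiff_cexp0 : cdiff (@cexp R) 0 1.
Proof.
move=> e e0.
pose e1 := Num.min 1 (e / 9).
have e10 : 0 < e1 by rewrite lt_min ltr01 divr_gt0.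
have e11 : e1 <= 1 by rewrite ge_min lexx.
have e1e : 9 * e1 <= e by rewrite -ler_pdivlMl// mulrC ge_min lexx orbT.
clearbody e1.
have [r1 r10 H1] := is_derive_epsilon (is_derive_expR (0:R)) e10.
have [r2 r20 H2] := is_derive_epsilon (is_derive_cos (0:R)) e10.
have [r3 r30 H3] := is_derive_epsilon (is_derive_sin (0:R)) e10.
exists (Num.min (Num.min r1 r2) (Num.min r3 e1)) => [|h].
  by rewrite !lt_min r10 r20 r30 e10.
rewrite !lt_min => /andP[/andP[h1 h2] /andP[h3 h4]].
rewrite add0r cexp0 mul1r.
set x := complex.Re h; set y := complex.Im h.
have hx : `|x| <= cabs h by exact: Re_le_cabs.
have hy : `|y| <= cabs h by exact: Im_le_cabs.
have := H1 _ (le_lt_trans hx h1); rewrite add0r expR0 mul1r => {}H1.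
have := H2 _ (le_lt_trans hy h2); rewrite add0r cos0 sin0 oppr0 mul0r subr0 => {}H2.
have := H3 _ (le_lt_trans hy h3); rewrite add0r cos0 sin0 subr0 mul1r => {}H3.
have c0 := cabs_ge0 h.
have ex0 := expR_gt0 x.
have xe1 : `|x| <= e1 by rewrite (le_trans hx)// ltW.
have ex3 : expR x <= 3.
  have : e1 * `|x| <= 1 by rewrite mulr_ile1 ?normr_ge0 ?(ltW e10)// (le_trans xe1).
  by move: H1; rewrite !ler_norml; move: xe1; rewrite ler_norml; lra.
have ex1 : `|expR x - 1| <= 2 * e1.
  have -> : expR x - 1 = (expR x - 1 - x) + x by ring.
  rewrite (le_trans (ler_normD _ _))// mulr_natl mulr2n lerD//.
  by rewrite (le_trans H1)// ler_piMr ?(ltW e10)// (le_trans xe1).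
apply: le_trans (cabs_le_ReIm _) _.
rewrite !ReD !ImD !ReN !ImN Re_cexp Im_cexp/= -/x -/y subr0.
have -> : expR x * cos y - 1 - x = (expR x - 1 - x) + expR x * (cos y - 1) by ring.
have -> : expR x * sin y - y = expR x * (sin y - y) + (expR x - 1) * y by ring.
have A1 : `|expR x * (cos y - 1)| <= 3 * (e1 * cabs h).
  rewrite normrM gtr0_norm// ler_pM ?(ltW ex0) ?normr_ge0//.
  by rewrite (le_trans H2)// ler_wpM2l ?(ltW e10).
have A2 : `|expR x * (sin y - y)| <= 3 * (e1 * cabs h).
  rewrite normrM gtr0_norm// ler_pM ?(ltW ex0) ?normr_ge0//.
  by rewrite (le_trans H3)// ler_wpM2l ?(ltW e10).
have A3 : `|(expR x - 1) * y| <= 2 * e1 * cabs h by rewrite normrM ler_pM.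
have A4 : `|expR x - 1 - x| <= e1 * cabs h.
  by rewrite (le_trans H1)// ler_wpM2l ?(ltW e10).
have : 9 * e1 * cabs h <= e * cabs h by rewrite ler_wpM2r.
have := ler_normD (expR x - 1 - x) (expR x * (cos y - 1)).
have := ler_normD (expR x * (sin y - y)) ((expR x - 1) * y).
lra.
Qed.

Lemma entire_cexp : entire (@cexp R).
Proof.
apply/entireP => z; exists (cexp z) => e e0.
have ez := expR_gt0 (complex.Re z).
have [r r0 H] := cdiff_cexp0 (divr_gt0 e0 ez).
exists r => // h /H; rewrite add0r cexp0 mul1r => {}H.
have -> : cexp (z + h) - cexp z - cexp z * h = cexp z * (cexp h - 1 - h).
  by rewrite cexpD; ring.
rewrite cabsM cabs_cexp (le_trans (ler_wpM2l (ltW ez) H))//.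
by rewrite mulrA [_ * (e / _)]mulrC divfK// gt_eqF.
Qed.

End Exponential.

Arguments entire_cexp {R} z.

(** * Goursat's theorem on rectangles *)

Section IntervalIntegral.
Variable R : realType.
Implicit Types (g : R -> R) (a b c m : R).

(** Integral of a real function over the segment [a, b]. *)
Definition segment_integral g a b : R := \int[@lebesgue_measure R]_(x in `[a, b]) g x.

Lemma segment_integrable g a b : continuous g ->
  (@lebesgue_measure R).-integrable `[a, b] (EFin \o g).
Proof.
move=> cg; apply: continuous_compact_integrable; first exact: segment_compact.
exact: continuous_subspaceT.
Qed.

Lemma segment_integral_cat g a m b : continuous g -> a <= m -> m <= b ->
  segment_integral g a b = segment_integral g a m + segment_integral g m b.
Proof.
move=> cg am mb; rewrite /segment_integral.
have /(_ (BLeft a) (BRight b) m) := @Rintegral_itvB R g.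
rewrite !bnd_simp => /(_ (segment_integrable a b cg) am mb).
rewrite Rintegral_itv_obnd_cbnd; first by move=> <-; rewrite addrC subrK.
apply: integrableS (segment_integrable a b cg) => //.
by apply: subset_itvr; rewrite bnd_simp.
Qed.

Lemma segment_integralB f g a b : continuous f -> continuous g ->
  segment_integral (fun x => f x - g x) a b =
  segment_integral f a b - segment_integral g a b.
Proof.
by move=> cf cg; rewrite /segment_integral RintegralB//; exact: segment_integrable.
Qed.

Lemma segment_integral_cst c a b : a <= b ->
  segment_integral (fun=> c) a b = c * (b - a).
Proof.
move=> ab; rewrite /segment_integral Rintegral_cst//= lebesgue_measure_itv/= lte_fin.
by have [//|] := ltP a b; move=> ba; rewrite (_ : b = a) ?subrr//; apply/le_anti; rewrite ab ba.
Qed.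

Lemma segment_integral_near g c e a b : continuous g -> a <= b ->
  (forall x, a <= x <= b -> `|g x - c| <= e) ->
  `|segment_integral g a b - c * (b - a)| <= e * (b - a).
Proof.
move=> cg ab H.
have cc k : continuous (fun _ : R => k : R) by exact: cst_continuous.
rewrite ler_distl; apply/andP; split.
- rewrite -mulrBl -segment_integral_cst// /segment_integral.
  apply: le_Rintegral => //; [exact: segment_integrable _ _ (cc _)|exact: segment_integrable|].
  move=> x /=; rewrite in_itv/= => /H; rewrite ler_distl => /andP[]; lra.
- rewrite -mulrDl -segment_integral_cst// /segment_integral.
  apply: le_Rintegral => //; [exact: segment_integrable|exact: segment_integrable _ _ (cc _)|].
  move=> x /=; rewrite in_itv/= => /H; rewrite ler_distl => /andP[]; lra.
Qed.

End IntervalIntegral.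

Section Bisection.
Variable R : realType.

(** Bisection principle for a property of the rectangles
    [x, x + L t] x [y, y + H t]: if it passes from the four quarters of a
    rectangle to the rectangle, and holds for all small rectangles around each
    point, then it holds for all rectangles of scale 1. *)
Lemma rectangle_bisection (L H : R) (P : R -> R -> R -> Prop) :
  0 < L -> 0 < H ->
  (forall x y t, 0 < t ->
    P x y (t / 2) -> P (x + L * (t / 2)) y (t / 2) ->
    P x (y + H * (t / 2)) (t / 2) ->
    P (x + L * (t / 2)) (y + H * (t / 2)) (t / 2) -> P x y t) ->
  (forall x0 y0, exists2 r, 0 < r & forall x y t, 0 < t -> t < r ->
    x <= x0 <= x + L * t -> y <= y0 <= y + H * t -> P x y t) ->
  forall x y, P x y 1.
Proof.
move=> L0 H0 quarters local x y; apply: contrapT => nP.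
have step (q : R * R * nat) : exists q' : R * R * nat,
    ~ P q.1.1 q.1.2 (2^-1 ^+ q.2) ->
    [/\ ~ P q'.1.1 q'.1.2 (2^-1 ^+ q'.2), q'.2 = q.2.+1,
        q.1.1 <= q'.1.1 <= q.1.1 + L * 2^-1 ^+ q'.2 &
        q.1.2 <= q'.1.2 <= q.1.2 + H * 2^-1 ^+ q'.2].
  case: q => -[a b] n /=.
  have [Pabn|nPabn] := pselect (P a b (2^-1 ^+ n)); first by exists (a, b, n).
  have t0 : 0 < 2^-1 ^+ n :> R by rewrite exprn_gt0// invr_gt0.
  have t1 : 0 < 2^-1 ^+ n.+1 :> R by rewrite exprn_gt0// invr_gt0.
  have hL : 0 <= L * 2^-1 ^+ n.+1 by rewrite mulr_ge0 ?ltW.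
  have hH : 0 <= H * 2^-1 ^+ n.+1 by rewrite mulr_ge0 ?ltW.
  have tE : 2^-1 ^+ n / 2 = 2^-1 ^+ n.+1 :> R by rewrite exprSr.
  apply: contrapT => none; apply: nPabn; apply: quarters => //; rewrite tE.
  - apply: contrapT => n1; apply: none; exists (a, b, n.+1) => _ /=.
    by split=> //; rewrite lexx lerDl.
  - apply: contrapT => n1; apply: none; exists (a + L * 2^-1 ^+ n.+1, b, n.+1) => _ /=.
    by split=> //; rewrite lexx lerDl ?hL.
  - apply: contrapT => n1; apply: none; exists (a, b + H * 2^-1 ^+ n.+1, n.+1) => _ /=.
    by split=> //; rewrite lexx lerDl ?hH.
  - apply: contrapT => n1; apply: none.
    exists (a + L * 2^-1 ^+ n.+1, b + H * 2^-1 ^+ n.+1, n.+1) => _ /=.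
    by split=> //; rewrite lexx lerDl ?hH ?hL.
have [next nextP] := choice step.
pose q n := iter n next (x, y, 0%N).
have qP n : ~ P (q n).1.1 (q n).1.2 (2^-1 ^+ n) /\ (q n).2 = n.
  elim: n => [|n [IH En]]; first by rewrite expr0.
  have := nextP (q n); rewrite En => /(_ IH) [h1 h2 _ _].
  by rewrite h2 in h1.
have qS n : [/\ (q n).1.1 <= (q n.+1).1.1 <= (q n).1.1 + L * 2^-1 ^+ n.+1 &
    (q n).1.2 <= (q n.+1).1.2 <= (q n).1.2 + H * 2^-1 ^+ n.+1].
  have [IH En] := qP n.
  have := nextP (q n); rewrite En => /(_ IH) [_ h2 h3 h4].
  by rewrite h2 in h3 h4.
have tS n : 2^-1 ^+ n = 2 * 2^-1 ^+ n.+1 :> R by rewrite exprS mulrA divff ?mul1r.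
have limit (u : nat -> R) (C : R) : 0 < C ->
    (forall n, u n <= u n.+1 <= u n + C * 2^-1 ^+ n.+1) ->
    exists l, forall n, u n <= l <= u n + C * 2^-1 ^+ n.
  move=> C0 uS.
  have up n k : u n <= u (n + k)%N.
    elim: k => [|k IH]; first by rewrite addn0.
    by rewrite addnS (le_trans IH)//; case/andP: (uS (n + k)%N).
  have down n k : u (n + k)%N + C * 2^-1 ^+ (n + k) <= u n + C * 2^-1 ^+ n.
    elim: k => [|k IH]; first by rewrite addn0.
    rewrite addnS (le_trans _ IH)// [X in _ <= _ + _ * X]tS.
    by case/andP: (uS (n + k)%N); lra.
  have pos n : 0 <= C * 2^-1 ^+ n by rewrite mulr_ge0 ?ltW// exprn_ge0// invr_ge0.
  have cross n m : u m <= u n + C * 2^-1 ^+ n.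
    have [nm|/ltnW mn] := leqP n m.
      rewrite -(subnKC nm); apply: le_trans (down n (m - n)%N).
      by rewrite lerDl.
    by rewrite -(subnKC mn) (le_trans (up m (n - m)%N))// lerDl.
  exists (sup (range u)) => n; apply/andP; split.
    apply: ub_le_sup; last by exists n.
    by exists (u 0%N + C * 2^-1 ^+ 0) => _ [k _ <-]; exact: cross.
  apply: ge_sup; first by exists (u 0%N); exists 0%N.
  by move=> _ [k _ <-]; exact: cross.
have [X hX] := limit (fun n => (q n).1.1) L L0 (fun n => proj1 (qS n)).
have [Y hY] := limit (fun n => (q n).1.2) H H0 (fun n => proj2 (qS n)).
have [r r0 small] := local X Y.
have [n nr] : exists n, 2^-1 ^+ n < r :> R.
  have : (2^-1 ^+ n : R) @[n --> \oo] --> 0.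
    by apply: cvg_expr; rewrite ger0_norm ?invr_ge0// invf_lt1 ?ltr1n.
  move=> /cvgrPdist_lt /(_ _ r0) [n _ /(_ n (leqnn n))].
  rewrite sub0r normrN ger0_norm ?exprn_ge0 ?invr_ge0// => ?.
  by exists n.
have [nPn _] := qP n; apply: nPn; exact: small.
Qed.

End Bisection.

Section Goursat.
Variable R : realType.

(** Goursat's theorem on a rectangle, in real form: a differential form
    [P dx + Q dy] whose coefficients are differentiable at every point, with
    [dP/dy = dQ/dx], has zero integral along the boundary.  No continuity of
    the partial derivatives is assumed. *)
Lemma goursat_rectangle (P Q : R -> R -> R) :
  (forall y, continuous (P^~ y)) -> (forall x, continuous (Q x)) ->
  (forall x0 y0, exists a b c, forall e, 0 < e -> exists2 r, 0 < r &
    forall x y, `|x - x0| < r -> `|y - y0| < r ->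
    `|P x y - P x0 y0 - a * (x - x0) - b * (y - y0)| <=
      e * (`|x - x0| + `|y - y0|) /\
    `|Q x y - Q x0 y0 - b * (x - x0) - c * (y - y0)| <=
      e * (`|x - x0| + `|y - y0|)) ->
  forall x1 x2 y1 y2, x1 < x2 -> y1 < y2 ->
  segment_integral (fun x => P x y1 - P x y2) x1 x2 +
  segment_integral (fun y => Q x2 y - Q x1 y) y1 y2 = 0.
Proof.
move=> cP cQ dPQ x1 x2 y1 y2 lx ly.
pose W u1 u2 v1 v2 := segment_integral (fun x => P x v1 - P x v2) u1 u2 +
  segment_integral (fun y => Q u2 y - Q u1 y) v1 v2.
rewrite -/(W x1 x2 y1 y2).
have cPP v1 v2 : continuous (fun x => P x v1 - P x v2).
  by move=> x; apply: cvgB; exact: cP.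
have cQQ v1 v2 : continuous (fun y => Q v1 y - Q v2 y).
  by move=> x; apply: cvgB; exact: cQ.
have Wx u1 u2 u3 v1 v2 : u1 <= u2 -> u2 <= u3 ->
    W u1 u3 v1 v2 = W u1 u2 v1 v2 + W u2 u3 v1 v2.
  move=> h1 h2; rewrite /W (segment_integral_cat (cPP _ _) h1 h2).
  rewrite !(segment_integralB _ _ (cQ _) (cQ _)); ring.
have Wy u1 u2 v1 v2 v3 : v1 <= v2 -> v2 <= v3 ->
    W u1 u2 v1 v3 = W u1 u2 v1 v2 + W u1 u2 v2 v3.
  move=> h1 h2; rewrite /W (segment_integral_cat (cQQ _ _) h1 h2).
  rewrite !(segment_integralB _ _ (cP _) (cP _)); ring.
pose L := x2 - x1; pose H := y2 - y1.
have L0 : 0 < L by rewrite subr_gt0.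
have H0 : 0 < H by rewrite subr_gt0.
suff main e : 0 < e -> `|W x1 x2 y1 y2| <= e.
  apply/eqP; rewrite -normr_eq0; apply/eqP/le_anti; rewrite normr_ge0 andbT.
  by apply/ler_addgt0Pl => e e0; rewrite addr0 main.
move=> e0.
have := @rectangle_bisection R L H
  (fun x y t => `|W x (x + L * t) y (y + H * t)| <= e * t ^+ 2) L0 H0.
move=> /(_ _ _ x1 y1); rewrite /= !mulr1 expr1n mulr1 !subrKC; apply.
- move=> x y t t0 h1 h2 h3 h4.
  have hL : 0 <= L * (t / 2) by rewrite mulr_ge0 ?ltW// divr_gt0.
  have hH : 0 <= H * (t / 2) by rewrite mulr_ge0 ?ltW// divr_gt0.
  have E u K : u + K * t = u + K * (t / 2) + K * (t / 2) by field.
  rewrite !E in h1 h2 h3 h4 *.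
  rewrite (@Wx x (x + L * (t / 2))) ?lerDl//.
  rewrite !(@Wy _ _ y (y + H * (t / 2)) (y + H * (t / 2) + H * (t / 2))) ?lerDl//.
  have -> : e * t ^+ 2 = (e * (t / 2) ^+ 2 + e * (t / 2) ^+ 2) +
    (e * (t / 2) ^+ 2 + e * (t / 2) ^+ 2) by field.
  rewrite (le_trans (ler_normD _ _))// lerD//.
    by rewrite (le_trans (ler_normD _ _))// lerD.
  by rewrite (le_trans (ler_normD _ _))// lerD.
- move=> x0 y0; have [a [b [c D]]] := dPQ x0 y0.
  have LH : 0 < L + H by rewrite addr_gt0.
  (* The affine parts of [P] and [Q] have zero boundary integral.  The
     remainders are at most [d (L + H) t] at each point, and opposite sides
     add up to a length of [(L + H) t], whence the factor 2 (L + H)^2. *)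
  pose d := e / (2 * (L + H) ^+ 2).
  have d0 : 0 < d by rewrite divr_gt0// mulr_gt0// exprn_gt0.
  have [r r0 Dr] := D _ d0.
  exists (r / (L + H)); first by rewrite divr_gt0.
  move=> x y t t0; rewrite ltr_pdivlMr// => tr /andP[hx1 hx2] /andP[hy1 hy2].
  have Lt0 : 0 <= L * t by rewrite mulr_ge0 ?ltW.
  have Ht0 : 0 <= H * t by rewrite mulr_ge0 ?ltW.
  have Kx u : x <= u <= x + L * t -> `|u - x0| <= L * t.
    by move=> /andP[? ?]; rewrite ler_norml; lra.
  have Ky v : y <= v <= y + H * t -> `|v - y0| <= H * t.
    by move=> /andP[? ?]; rewrite ler_norml; lra.
  have Dr' u v : x <= u <= x + L * t -> y <= v <= y + H * t ->
    `|P u v - P x0 y0 - a * (u - x0) - b * (v - y0)| <= d * ((L + H) * t) /\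
    `|Q u v - Q x0 y0 - b * (u - x0) - c * (v - y0)| <= d * ((L + H) * t).
    move=> /Kx hu /Ky hv.
    have [||k1 k2] := Dr u v; [lra|lra|].
    have B : d * (`|u - x0| + `|v - y0|) <= d * ((L + H) * t).
      by rewrite ler_wpM2l ?(ltW d0)// mulrDl lerD.
    by split; [exact: le_trans k1 B|exact: le_trans k2 B].
  have yl : y <= y <= y + H * t by rewrite lexx lerDl.
  have yr : y <= y + H * t <= y + H * t by rewrite lexx lerDl andbT.
  have xl : x <= x <= x + L * t by rewrite lexx lerDl.
  have xr : x <= x + L * t <= x + L * t by rewrite lexx lerDl andbT.
  set D1 := d * ((L + H) * t) in Dr'.
  have I1 := @segment_integral_near R (fun u => P u y - P u (y + H * t))
    (- (b * (H * t))) (2 * D1) x (x + L * t) (cPP _ _).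
  have I2 := @segment_integral_near R (fun v => Q (x + L * t) v - Q x v)
    (b * (L * t)) (2 * D1) y (y + H * t) (cQQ _ _).
  have {}I1 : `|segment_integral (fun u => P u y - P u (y + H * t)) x (x + L * t)
      - - (b * (H * t)) * (x + L * t - x)| <= 2 * D1 * (x + L * t - x).
    apply: I1; first by rewrite lerDl.
    move=> u hu; have [A1 _] := Dr' u _ hu yl; have [A2 _] := Dr' u _ hu yr.
    move: A1 A2; rewrite !ler_norml; lra.
  have {}I2 : `|segment_integral (fun v => Q (x + L * t) v - Q x v) y (y + H * t)
      - (b * (L * t)) * (y + H * t - y)| <= 2 * D1 * (y + H * t - y).
    apply: I2; first by rewrite lerDl.
    move=> v hv; have [_ A1] := Dr' _ v xl hv; have [_ A2] := Dr' _ v xr hv.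
    move: A1 A2; rewrite !ler_norml; lra.
  have -> : e * t ^+ 2 = 2 * D1 * (x + L * t - x) + 2 * D1 * (y + H * t - y).
    rewrite /D1 /d; field; exact: lt0r_neq0.
  rewrite /W.
  set S1 := segment_integral _ _ _ in I1 *.
  set S2 := segment_integral _ _ _ in I2 *.
  have -> : S1 + S2 = (S1 - - (b * (H * t)) * (x + L * t - x)) +
     (S2 - (b * (L * t)) * (y + H * t - y)) by ring.
  by rewrite (le_trans (ler_normD _ _))// lerD.
Qed.

End Goursat.

(** * Cauchy's estimate *)

Section CauchyEstimate.
Variable R : realType.
Implicit Types (f g : R[i] -> R[i]) (z w : R[i]).

Lemma derivative_of_epsilon (f : R -> R) (a d : R) :
  (forall e : R, 0 < e -> exists2 r : R, 0 < r &
    forall h, `|h| < r -> `|f (a + h) - f a - d * h| <= e * `|h|) ->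
  is_derive a 1 f d.
Proof.
move=> H.
have cv : (h^-1 *: ((f \o shift a) (h *: 1) - f a) : R) @[h --> 0^'] --> d.
  apply/cvgrPdist_le => /= e e0; have [r r0 Hr] := H _ e0.
  near=> h.
  have hn0 : h != 0 by near: h; exact: (@nbhs_dnbhs_neq R).
  have hr : `|h| < r by near: h; apply: (@dnbhs0_lt R R).
  rewrite {1 2}/GRing.scale/= mulr1 (addrC h).
  have -> : d - h^-1 * (f (a + h) - f a) =
      - (h^-1 * (f (a + h) - f a - d * h)) by field.
  by rewrite normrN normrM normfV ler_pdivrMl ?normr_gt0// (mulrC `|h|) Hr.
by apply: DeriveDef; [apply/cvg_ex; exists d | apply/cvg_lim].
Unshelve. all: by end_near. Qed.

Lemma derivative_continuous (f : R -> R) (a d : R) : is_derive a 1 f d ->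
  {for a, continuous f}.
Proof. by move=> [df _]; exact/differentiable_continuous/derivable1_diffP. Qed.

(** Only real functions are differentiated along lines: the imaginary part of
    [f] is the real part of [- i f], see [Im_Re]. *)
Lemma cdiff_Re_line f z k d (t : R) : cdiff f (z + t%:C * k) d ->
  is_derive t 1 (fun s : R => complex.Re (f (z + s%:C * k))) (complex.Re (d * k)).
Proof.
move=> H; apply: derivative_of_epsilon => e e0.
have k0 := cabs_ge0 k.
have K : 0 < 1 + cabs k by rewrite ltr_wpDr.
have [r r0 Hr] := H _ (divr_gt0 e0 K).
exists (r / (1 + cabs k)) => [|s]; first by rewrite divr_gt0.
rewrite ltr_pdivlMr// => sr.
have sk : cabs (s%:C * k) = `|s| * cabs k by rewrite cabsM cabs_real.
have /Hr : cabs (s%:C * k) < r.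
  by rewrite sk (le_lt_trans _ sr)// ler_wpM2l// lerDr.
have -> : z + t%:C * k + s%:C * k = z + (t + s)%:C * k by rewrite rmorphD/=; ring.
move=> H1.
have -> : complex.Re (f (z + (t + s)%:C * k)) - complex.Re (f (z + t%:C * k)) -
   complex.Re (d * k) * s = complex.Re (f (z + (t + s)%:C * k) -
     f (z + t%:C * k) - d * (s%:C * k)).
  by rewrite !ReD !ReN; congr (_ - _); rewrite !ReM !ImM/=; ring.
rewrite (le_trans (Re_le_cabs _))// (le_trans H1)// sk.
rewrite -mulrA ler_wpM2l ?(ltW e0)// mulrC -mulrA ler_piMr//.
by rewrite ler_pdivrMr// mul1r lerDr.
Qed.

Lemma cdiffZ f z d (c : R[i]) : cdiff f z d -> cdiff (fun x => c * f x) z (c * d).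
Proof.
move=> H e e0.
have K : 0 < 1 + cabs c by rewrite ltr_wpDr ?cabs_ge0.
have [r r0 Hr] := H _ (divr_gt0 e0 K); exists r => // h /Hr H1.
have -> : c * f (z + h) - c * f z - c * d * h = c * (f (z + h) - f z - d * h).
  by ring.
rewrite cabsM (le_trans (ler_wpM2l (cabs_ge0 c) H1))// mulrA ler_wpM2r ?cabs_ge0//.
by rewrite mulrA ler_pdivrMr// mulrC ler_wpM2l ?(ltW e0)// lerDr.
Qed.

Lemma cdiffB f g z d d' : cdiff f z d -> cdiff g z d' ->
  cdiff (fun x => f x - g x) z (d - d').
Proof.
move=> Hf Hg e e0; have e2 : 0 < e / 2 by rewrite divr_gt0.
have [r r0 Hr] := Hf _ e2; have [s s0 Hs] := Hg _ e2.
exists (Num.min r s) => [|h]; first by rewrite lt_min r0.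
rewrite lt_min => /andP[/Hr A /Hs B].
have -> : f (z + h) - g (z + h) - (f z - g z) - (d - d') * h =
  (f (z + h) - f z - d * h) - (g (z + h) - g z - d' * h) by ring.
by rewrite (le_trans (cabsB _ _))//; lra.
Qed.

Lemma cdiff_shift f z d (c : R[i]) : cdiff f (z + c) d ->
  cdiff (fun x => f (x + c)) z d.
Proof.
move=> H e e0; have [r r0 Hr] := H e e0.
by exists r => // h /Hr; rewrite (addrAC z c h).
Qed.

Lemma cdiff_id z : cdiff id z 1.
Proof.
move=> e e0; exists 1 => // h _.
have -> : id (z + h) - id z - 1 * h = 0 by rewrite /= mul1r (addrC z) addrK subrr.
by rewrite cabs0 mulr_ge0 ?cabs_ge0 ?ltW.
Qed.

Lemma Im_Re z : complex.Im z = complex.Re (- 'i%C * z).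
Proof. by case: z => a b; rewrite ReM/=; ring. Qed.

Lemma cabs_Ni : cabs (- 'i%C : R[i]) = 1.
Proof. by rewrite cabsN cabsE/= expr0n/= add0r expr1n sqrtr1. Qed.

(** Mean value inequality on the segment [z, z + k]. *)
Lemma cdiff_segment f (D : R[i] -> R[i]) z k (K : R) :
  (forall t : R, 0 <= t <= 1 -> cdiff f (z + t%:C * k) (D (z + t%:C * k)) /\
     cabs (D (z + t%:C * k)) <= K) ->
  cabs (f (z + k) - f z) <= 2 * K * cabs k.
Proof.
have real f' (D' : R[i] -> R[i]) : (forall t : R, 0 <= t <= 1 ->
     cdiff f' (z + t%:C * k) (D' (z + t%:C * k)) /\
     cabs (D' (z + t%:C * k)) <= K) ->
    `|complex.Re (f' (z + k) - f' z)| <= K * cabs k.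
  move=> H.
  pose u (s : R) := complex.Re (f' (z + s%:C * k)).
  have [c c01] : exists2 c, c \in `]0, 1[%R &
      u 1 - u 0 = complex.Re (D' (z + c%:C * k) * k) * (1 - 0).
    apply: (@MVT R u (fun c => complex.Re (D' (z + c%:C * k) * k))) => //.
      move=> x; rewrite in_itv/= => /andP[x0 x1].
      by apply: cdiff_Re_line; apply: (H x _).1; rewrite !ltW.
    apply: continuous_in_subspaceT => x; rewrite inE/= in_itv/= => x01.
    by apply: derivative_continuous; apply: cdiff_Re_line; exact: (H x x01).1.
  rewrite /u mul1r mul0r addr0 subr0 mulr1 -ReN -ReD => ->.
  rewrite (le_trans (Re_le_cabs _))// cabsM ler_wpM2r ?cabs_ge0//.
  by apply: (H c _).2; move: c01; rewrite in_itv/= => /andP[? ?]; rewrite !ltW.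
move=> H; rewrite (le_trans (cabs_le_ReIm _))// -mulrA mulr_natl mulr2n lerD//.
  exact: (real f D).
rewrite Im_Re mulrBr; apply: (real (fun x => - 'i%C * f x) (fun x => - 'i%C * D x)).
move=> t t01; have [h1 h2] := H t t01; split; first exact: cdiffZ.
by rewrite cabsM cabs_Ni mul1r.
Qed.

Lemma entire_line_continuous f (x y : R[i]) : entire f ->
  continuous (fun t : R => complex.Re (f (x + t%:C * y))).
Proof.
move=> /entireP ef t; have [d hd] := ef (x + t%:C * y).
exact/derivative_continuous/cdiff_Re_line/hd.
Qed.

Lemma complex_line (x y : R) : x +i* y = x%:C + y%:C * 'i%C :> R[i].
Proof. by simpc. Qed.

(** The mean over a period of a periodic entire function does not depend on
    the vertical line: the two horizontal sides of the rectangle cancel. *)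
Lemma periodic_mean h : entire h ->
  (forall x : R, h (x +i* (2 * pi)) = h (x +i* 0)) ->
  forall x1 x2 : R, x1 < x2 ->
  segment_integral (fun y => complex.Re (h (x1 +i* y))) 0 (2 * pi) =
  segment_integral (fun y => complex.Re (h (x2 +i* y))) 0 (2 * pi).
Proof.
move=> eh per x1 x2 x12.
have pi2 : 0 < 2 * pi :> R by rewrite mulr_gt0 ?pi_gt0.
have cQ (x : R) : continuous (fun y => complex.Re (h (x +i* y))).
  have -> : (fun y => complex.Re (h (x +i* y))) =
      (fun y : R => complex.Re (h (x%:C + y%:C * 'i%C))).
    by apply/funext => y; rewrite complex_line.
  exact: entire_line_continuous.
have cP (y : R) : continuous (fun x => complex.Im (h (x +i* y))).
  have -> : (fun x => complex.Im (h (x +i* y))) =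
      (fun x : R => complex.Re (- 'i%C * h (y%:C * 'i%C + x%:C * 1))).
    by apply/funext => x; rewrite complex_line Im_Re mulr1 addrC.
  apply: (@entire_line_continuous (fun z => - 'i%C * h z)).
  exact: entireZ.
have := @goursat_rectangle R (fun x y => complex.Im (h (x +i* y)))
  (fun x y => complex.Re (h (x +i* y))) cP cQ _ x1 x2 0 (2 * pi) x12 pi2.
have -> : (fun x => complex.Im (h (x +i* 0)) - complex.Im (h (x +i* (2 * pi)))) =
    (fun=> 0) by apply/funext => x; rewrite per subrr.
rewrite segment_integral_cst ?(ltW x12)// mul0r add0r segment_integralB//.
move=> E; apply/esym/subr0_eq; apply: E => x0 y0.
have [d hd] := (entireP h).1 eh (x0 +i* y0).
exists (complex.Im d), (complex.Re d), (- complex.Im d) => e e0.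
have [r r0 Hr] := hd _ e0; exists (r / 2) => [|x y hx hy]; first by rewrite divr_gt0.
set k := (x - x0) +i* (y - y0).
have kle : cabs k <= `|x - x0| + `|y - y0| by exact: cabs_pair_le.
have /Hr : cabs k < r by lra.
have -> : x0 +i* y0 + k = x +i* y by rewrite /k; simpc; rewrite !subrKC.
move=> Hk.
have Hk' : e * cabs k <= e * (`|x - x0| + `|y - y0|) by rewrite ler_wpM2l// ltW.
have {}Hk := le_trans Hk Hk'.
split; [have := le_trans (Im_le_cabs _) Hk | have := le_trans (Re_le_cabs _) Hk].
  by rewrite !ImD !ImN ImM/= opprD addrA (addrAC _ (- (complex.Re d * _))).
by rewrite !ReD !ReN ReM/= opprB addrA mulNr opprK (addrAC _ (complex.Im d * _)).
Qed.

(** Cauchy's estimate for the derivative on discs of radius 1, obtained by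
    applying [periodic_mean] to [(f (w + exp t) - f w) exp (- t)], which tends
    to [f' w] as [Re t] tends to minus infinity. *)
Lemma cauchy_estimate f w d (M : R) : entire f -> cdiff f w d ->
  (forall z, cabs (z - w) <= 1 -> cabs (f z) <= M) -> cabs d <= 4 * M.
Proof.
have real f' d' : entire f' -> cdiff f' w d' ->
    (forall z, cabs (z - w) <= 1 -> cabs (f' z) <= M) ->
    `|complex.Re d'| <= 2 * M.
  move=> ef df fM.
  have pi2 : 0 < 2 * pi :> R by rewrite mulr_gt0 ?pi_gt0.
  pose h t := (f' (w + cexp t) - f' w) * cexp (- t).
  have eh : entire h.
    have e1 : entire (fun t => w + cexp t).
      exact: (entireD (entire_cst w) entire_cexp).
    have e2 : entire (fun t => f' (w + cexp t) - f' w).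
      exact: (entireB (entire_comp ef e1) (entire_cst (f' w))).
    have e3 : entire (fun z : R[i] => - z).
      have -> : (fun z : R[i] => - z) = (fun z => 0 - z).
        by apply/funext => z; rewrite sub0r.
      exact: (entireB (entire_cst 0) entire_id).
    exact: (entireM e2 (entire_comp entire_cexp e3)).
  have per (x : R) : h (x +i* (2 * pi)) = h (x +i* 0).
    rewrite /h; have := cexp_periodic x 0; rewrite add0r => ->.
    have := cexp_periodic (- x) (- (2 * pi)); rewrite addNr => E.
    have -> : - (x +i* (2 * pi)) = (- x) +i* (- (2 * pi)) by simpc.
    have -> : - (x +i* 0) = (- x) +i* 0 by apply/eqP; rewrite eq_complex/= oppr0 !eqxx.
    by rewrite E.
  apply/ler_addgt0Pl => e e0; rewrite addrC.
  (* On the line [Re t = s] the function [h] is within [e] of [d'], and on the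
     line [Re t = 0] it is bounded by [2 M]. *)
  have [r r0 Hr] := df _ e0.
  pose s := Num.min (-1) (ln (r / 2)).
  have s0 : s < 0 by rewrite gt_min ltrN10.
  have sr : expR s < r.
    rewrite (@le_lt_trans _ _ (r / 2))//; last by lra.
    by rewrite -[leRHS]lnK ?posrE ?divr_gt0// ler_expR ge_min lexx orbT.
  have hcont (x : R) : continuous (fun y => complex.Re (h (x +i* y))).
    have -> : (fun y => complex.Re (h (x +i* y))) =
      (fun y : R => complex.Re (h (x%:C + y%:C * 'i%C))).
      by apply/funext => y; rewrite complex_line.
    exact: entire_line_continuous.
  have I1 := @segment_integral_near R (fun y => complex.Re (h (s +i* y)))
     (complex.Re d') e 0 (2 * pi) (hcont s) (ltW pi2).
  have I2 := @segment_integral_near R (fun y => complex.Re (h (0 +i* y)))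
     0 (2 * M) 0 (2 * pi) (hcont 0) (ltW pi2).
  rewrite (periodic_mean eh per s0) in I1.
  have {}I1 := I1 _; have {}I2 := I2 _.
  have : `|complex.Re d' * (2 * pi)| <= (2 * M + e) * (2 * pi).
    move: I1 I2; rewrite !subr0 mul0r subr0.
    set I := segment_integral _ _ _ => I1 I2.
    have {}I1 : `|I - complex.Re d' * (2 * pi)| <= e * (2 * pi).
      apply: I1 => y _; rewrite -ReN -ReD (le_trans (Re_le_cabs _))//.
      have E0 : cexp (s +i* y) * cexp (- (s +i* y)) = 1.
        by rewrite -cexpD subrr cexp0.
      have -> : h (s +i* y) - d' = (f' (w + cexp (s +i* y)) - f' w -
          d' * cexp (s +i* y)) * cexp (- (s +i* y)).
        by rewrite mulrBl -mulrA E0 mulr1.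
      have c1 : cabs (cexp (s +i* y)) = expR s by rewrite cabs_cexp.
      have c2 : cabs (cexp (- (s +i* y))) = (expR s)^-1.
        by rewrite cabs_cexp/= expRN.
      have := Hr (cexp (s +i* y)); rewrite c1 => /(_ sr) Hs.
      by rewrite cabsM c2 ler_pdivrMr ?expR_gt0.
    have {}I2 : `|I| <= 2 * M * (2 * pi).
      apply: I2 => y _; rewrite subr0 (le_trans (Re_le_cabs _))//.
      rewrite /h cabsM cabs_cexp/= oppr0 expR0 mulr1 (le_trans (cabsB _ _))//.
      rewrite mulr_natl mulr2n lerD// fM ?subrr ?cabs0//.
      by rewrite addrC addKr cabs_cexp/= expR0.
    move: I1 I2; rewrite !ler_norml; lra.
  by rewrite normrM (gtr0_norm pi2) ler_pM2r.
move=> ef df fM.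
rewrite (le_trans (cabs_le_ReIm _))// (_ : 4 * M = 2 * M + 2 * M); last by ring.
rewrite lerD//; first exact: (real f d).
rewrite Im_Re; apply: (real (fun z => - 'i%C * f z)).
- exact: entireZ.
- exact: cdiffZ.
- by move=> z zw; rewrite cabsM cabs_Ni mul1r fM.
Qed.

End CauchyEstimate.

(** * Montel's theorem *)

Section Montel.
Variable R : realType.

(** Sequential form of Tychonoff's theorem: a pointwise bounded sequence of
    real functions has a cluster point for pointwise convergence. *)
Lemma pointwise_cluster (I : eqType) (v : nat -> I -> R) :
  (forall i, exists B, forall n, `|v n i| <= B) ->
  exists l : I -> R, forall (s : seq I) (e : R) (N : nat), 0 < e ->
    exists2 n, (N <= n)%N & forall i, i \in s -> `|v n i - l i| < e.
Proof.
move=> /choice [B vB].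
have comp i : compact (`[- B i, B i] : set R) by exact: segment_compact.
have := @tychonoff I (fun=> R) (fun i => [set` `[- B i, B i]]) comp.
pose K : set (prod_topology (fun _ : I => R)) := [set f | forall i, `[- B i, B i]%classic (f i)].
move=> /(_ (v @ \oo) _); case.
  exists 0%N => // n _ i /=; rewrite in_itv/=.
  by have := vB i n; rewrite ler_norml.
move=> l [_ cl]; exists l => s e N e0.
pose A : set (prod_topology (fun _ : I => R)) :=
  [set f | exists2 n, (N <= n)%N & f = v n].
pose U : set (prod_topology (fun _ : I => R)) :=
  [set f | forall i, i \in s -> `|f i - l i| < e].
have FA : (v @ \oo) A by exists N => // n /= Nn; exists n.
have nU : nbhs (l : prod_topology (fun _ : I => R)) U.
  rewrite /U; elim: s {U} => [|i s IH].
    suff -> : [set f : prod_topology (fun _ : I => R) |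
        forall i, i \in [::] -> `|f i - l i| < e] = setT by exact: filterT.
    by rewrite -subTset => f _ i.
  have n1 : nbhs (l : prod_topology (fun _ : I => R))
      [set f : prod_topology (fun _ : I => R) | `|f i - l i| < e].
    have nR : nbhs (l i : R) [set x : R | `|x - l i| < e].
      by exists e => //= x; rewrite /ball_/= distrC.
    exact: (@proj_continuous I (fun=> R) i l _ nR).
  apply: filterS (filterI n1 IH) => f [/= fi fs] j.
  by rewrite inE => /orP[/eqP ->//|/fs].
have [f [[n Nn ->] fU]] := cl _ _ FA nU.
by exists n.
Qed.

(** An enumeration of the points of the plane with rational coordinates. *)
Definition rational_point (n : nat) : R[i] :=
  if @unpickle (rat * rat)%type n is Some q then ratr q.1 +i* ratr q.2 else 0.

Lemma rational_point_dense (z : R[i]) (e : R) : 0 < e ->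
  exists k, cabs (rational_point k - z) < e.
Proof.
move=> e0; have e2 : 0 < e / 2 by rewrite divr_gt0.
have [a] : exists a : rat, ratr a \in `]complex.Re z, (complex.Re z + e / 2)[.
  by have [|a] := @rat_in_itvoo R (complex.Re z) (complex.Re z + e / 2);
    [rewrite ltrDl | exists a].
have [b] : exists b : rat, ratr b \in `]complex.Im z, (complex.Im z + e / 2)[.
  by have [|b] := @rat_in_itvoo R (complex.Im z) (complex.Im z + e / 2);
    [rewrite ltrDl | exists b].
rewrite !in_itv/= => /andP[b1 b2] /andP[a1 a2].
exists (pickle (a, b)); rewrite /rational_point pickleK/=.
rewrite (le_lt_trans (cabs_le_ReIm _))// ReD ImD ReN ImN/=.
by rewrite !gtr0_norm ?subr_gt0//; lra.
Qed.

(** Estimates for a family of entire functions [f n] with derivatives [D n],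
    bounded by [B r] on the disc of radius [r]; they do not depend on [n]. *)
Section LocallyBounded.
Variables (f D : nat -> R[i] -> R[i]) (B : R -> R).
Hypotheses (ef : forall n, entire (f n)) (fD : forall n z, cdiff (f n) z (D n z)).
Hypothesis fB : forall n z r, cabs z <= r -> cabs (f n z) <= B r.

Let B_ge0 r : 0 <= r -> 0 <= B r.
Proof. by move=> r0; apply: le_trans (cabs_ge0 _) (@fB 0%N 0 r _); rewrite cabs0. Qed.

Lemma local_derivative_bound n z r : cabs z <= r -> cabs (D n z) <= 4 * B (r + 1).
Proof.
move=> zr.
apply: (cauchy_estimate (@ef n) (@fD n z)) => x xz; apply: fB.
by rewrite -(subrK z x) (le_trans (cabsD _ _))// addrC lerD.
Qed.

Lemma local_lipschitz n z h r : cabs z <= r -> cabs (z + h) <= r ->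
  cabs (f n (z + h) - f n z) <= 8 * B (r + 1) * cabs h.
Proof.
move=> zr zhr; rewrite (_ : 8 * B (r + 1) = 2 * (4 * B (r + 1))); last by ring.
apply: (@cdiff_segment R (f n) (D n)) => t /andP[t0 t1]; split; first exact: (@fD n).
apply: local_derivative_bound.
have -> : z + t%:C * h = (1 - t)%:C * z + t%:C * (z + h).
  by rewrite rmorphB/= rmorph1; ring.
rewrite (le_trans (cabsD _ _))// !cabsM !cabs_real !ger0_norm ?subr_ge0//.
have -> : r = (1 - t) * r + t * r by ring.
by rewrite lerD// ler_wpM2l// subr_ge0.
Qed.

(** The Cauchy estimate for [f (. + h) - f]. *)
Lemma local_derivative_lipschitz n z h r : cabs z <= r -> cabs h <= 1 ->
  cabs (D n (z + h) - D n z) <= 32 * B (r + 3) * cabs h.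
Proof.
move=> zr h1; rewrite (_ : 32 * B (r + 3) * cabs h = 4 * (8 * B (r + 3) * cabs h)); last by ring.
apply: (@cauchy_estimate R (fun x => f n (x + h) - f n x) z).
- have e1 : entire (fun x => x + h) by exact: (entireD entire_id (entire_cst h)).
  exact: (entireB (entire_comp (@ef n) e1) (@ef n)).
- by apply: cdiffB => //; apply: cdiff_shift.
- move=> x xz.
  have xr : cabs x <= r + 1.
    by rewrite -(subrK z x) (le_trans (cabsD _ _))// addrC lerD.
  rewrite (_ : r + 3 = (r + 2) + 1); last by ring.
  apply: local_lipschitz; first by rewrite (le_trans xr)// lerD2l ler1n.
  by rewrite (le_trans (cabsD _ _))// (_ : r + 2 = (r + 1) + 1) ?lerD//; ring.
Qed.

Lemma local_quadratic n z h r : cabs z <= r -> cabs h <= 1 ->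
  cabs (f n (z + h) - f n z - D n z * h) <= 64 * B (r + 3) * cabs h ^+ 2.
Proof.
move=> zr h1.
have r0 : 0 <= r by rewrite (le_trans (cabs_ge0 _) zr).
have -> : f n (z + h) - f n z - D n z * h =
    (f n (z + h) - D n z * (z + h)) - (f n z - D n z * z) by ring.
rewrite (_ : 64 * B (r + 3) * cabs h ^+ 2 = 2 * (32 * B (r + 3) * cabs h) * cabs h); last by ring.
apply: (@cdiff_segment R (fun x => f n x - D n z * x) (fun x => D n x - D n z)).
move=> t /andP[t0 t1]; split.
  apply: cdiffB => //; rewrite -[X in cdiff _ _ X]mulr1.
  exact/cdiffZ/cdiff_id.
have th : cabs (t%:C * h) <= cabs h.
  by rewrite cabsM cabs_real ger0_norm// ler_piMl// cabs_ge0.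
rewrite (le_trans (@local_derivative_lipschitz _ _ _ r _ _))//.
  exact: le_trans th h1.
by rewrite ler_wpM2l// mulr_ge0// B_ge0// addr_ge0.
Qed.

End LocallyBounded.

(** Montel's theorem: a locally bounded sequence of entire functions has a
    subsequence converging pointwise to an entire function.  The cluster point
    is taken for the functions and their derivatives at once, so that the
    second order estimate passes to the limit and makes it entire. *)
Lemma montel (f : nat -> R[i] -> R[i]) (B : R -> R) :
  (forall n, entire (f n)) ->
  (forall n z r, cabs z <= r -> cabs (f n z) <= B r) ->
  exists (phi : nat -> nat) (g : R[i] -> R[i]),
    [/\ {homo phi : m n / (m < n)%N >-> (m < n)%N}, entire g &
      forall z (e : R), 0 < e -> exists N, forall n, (N <= n)%N ->
        cabs (f (phi n) z - g z) <= e].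
Proof.
move=> ef fB.
have /choice [D fD] : forall n, exists Dn, forall z, cdiff (f n) z (Dn z).
  by move=> n; have [Dn] := choice ((entireP (f n)).1 (ef n)); exists Dn.
pose v n (i : bool * bool * R[i]) : R :=
  let c := if i.1.1 then f n i.2 else D n i.2 in
  if i.1.2 then complex.Re c else complex.Im c.
have B0 z r : cabs z <= r -> 0 <= B r.
  by move=> zr; apply: le_trans (fB 0%N z r zr); exact: cabs_ge0.
(* Real and imaginary parts of the functions and of their derivatives. *)
have [l lP] : exists l : bool * bool * R[i] -> R,
    forall (s : seq (bool * bool * R[i])) (e : R) (N : nat), 0 < e ->
    exists2 n, (N <= n)%N & forall i, i \in s -> `|v n i - l i| < e.
  apply: pointwise_cluster => -[[a b] z].
  exists (B (cabs z) + 4 * B (cabs z + 1)) => n; rewrite /v/=.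
  have hf := fB n z _ (lexx _).
  have hD := local_derivative_bound ef fD fB n (lexx (cabs z)).
  have c1 := cabs_ge0 (f n z); have c2 := cabs_ge0 (D n z).
  have := Re_le_cabs (f n z); have := Im_le_cabs (f n z).
  have := Re_le_cabs (D n z); have := Im_le_cabs (D n z).
  by case: a; case: b; lra.
pose g z := l (true, true, z) +i* l (true, false, z).
pose G z := l (false, true, z) +i* l (false, false, z).
have cl (s : seq R[i]) (e : R) (N : nat) : 0 < e -> exists2 n, (N <= n)%N &
    forall z, z \in s -> cabs (f n z - g z) <= e /\ cabs (D n z - G z) <= e.
  move=> e0; have e2 : 0 < e / 2 by rewrite divr_gt0.
  have [n Nn Hn] := lP [seq (i, z) | i <- [:: (true, true); (true, false);
    (false, true); (false, false)], z <- s] _ N e2.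
  exists n => // z zs.
  have K (i : bool * bool) : `|v n (i, z) - l (i, z)| < e / 2.
    by apply: Hn; apply/allpairsP; exists (i, z); split=> //; case: i => [[] []].
  split; rewrite (le_trans (cabs_le_ReIm _))// ReD ImD ReN ImN/=.
    by have := K (true, true); have := K (true, false); rewrite /v/=; lra.
  by have := K (false, true); have := K (false, false); rewrite /v/=; lra.
have eg : entire g.
  apply/entireP => z; exists (G z).
  pose C := 64 * B (cabs z + 3).
  have C0 : 0 <= C by rewrite mulr_ge0// (B0 z)// lerDl.
  have quad h : cabs h <= 1 -> cabs (g (z + h) - g z - G z * h) <= C * cabs h ^+ 2.
    move=> h1; apply/ler_addgt0Pr => e e0.
    have e3 : 0 < e / 3 by rewrite divr_gt0.
    have [n _ Hn] := cl [:: z; z + h] _ 0%N e3.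
    have [|a1 a2] := Hn z; first by rewrite inE eqxx.
    have [|b1 _] := Hn (z + h); first by rewrite !inE eqxx orbT.
    have Q := local_quadratic ef fD fB n (lexx (cabs z)) h1.
    have -> : g (z + h) - g z - G z * h = (f n (z + h) - f n z - D n z * h) -
      (f n (z + h) - g (z + h)) + (f n z - g z) + (D n z - G z) * h by ring.
    have a3 : cabs ((D n z - G z) * h) <= e / 3.
      by rewrite cabsM (le_trans _ a2)// ler_piMr// cabs_ge0.
    apply: le_trans (cabsD _ _) _; apply: le_trans (lerD (cabsD _ _) (lexx _)) _.
    apply: le_trans (lerD (lerD (cabsB _ _) (lexx _)) (lexx _)) _.
    move: Q; rewrite -/C; lra.
  move=> e e0; exists (Num.min 1 (e / (1 + C))) => [|h].
    by rewrite lt_min ltr01 divr_gt0// ltr_wpDr.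
  rewrite lt_min => /andP[h1 h2]; rewrite (le_trans (quad h (ltW h1)))//.
  rewrite expr2 mulrA ler_wpM2r ?cabs_ge0//.
  have C1 : 0 < 1 + C by rewrite ltr_wpDr.
  move: h2; rewrite ltr_pdivlMr// => h2.
  by rewrite (le_trans _ (ltW h2))// mulrC ler_wpM2l ?cabs_ge0// lerDr.
(* The [j]-th term of the subsequence is within [1 / (j + 1)] of [g] at the
   first [j + 1] rational points. *)
have /choice [nxt nxtP] : forall Nj : nat * nat, exists n, (Nj.1 <= n)%N /\
    forall k, (k <= Nj.2)%N ->
      cabs (f n (rational_point k) - g (rational_point k)) <= Nj.2.+1%:R^-1.
  move=> [N j] /=.
  have [n Nn Hn] := cl [seq rational_point k | k <- iota 0 j.+1] j.+1%:R^-1 N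
    ltac:(by rewrite invr_gt0).
  exists n; split=> // k kj; apply: (Hn _ _).1.
  by apply/map_f; rewrite mem_iota.
pose phi := fix phi j := if j is j'.+1 then nxt ((phi j').+1, j) else nxt (0%N, 0%N).
have phiS j : (phi j < phi j.+1)%N by have [] := nxtP ((phi j).+1, j.+1).
have phiP j k : (k <= j)%N ->
    cabs (f (phi j) (rational_point k) - g (rational_point k)) <= j.+1%:R^-1.
  case: j => [|j] kj /=; first by have [_] := nxtP (0%N, 0%N); exact.
  by have [_] := nxtP ((phi j).+1, j.+1); exact.
exists phi, g; split=> //.
  move=> m n; elim: n => // n IH; rewrite ltnS leq_eqVlt => /orP[/eqP ->//|/IH mn].
  exact: ltn_trans mn (phiS n).
move=> z e e0.
(* At [z], compare with a rational point [q] at distance at most [e / (4 K)],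
   where [K] bounds the Lipschitz constants near [z]. *)
pose K := 1 + 8 * B (cabs z + 2).
have K0 : 0 < K by rewrite ltr_pwDl// mulr_ge0// (B0 z)// lerDl.
have e3 : 0 < e / 4 by rewrite divr_gt0.
have [k kz] := @rational_point_dense z (Num.min 1 (e / 4 / K))
  ltac:(by rewrite lt_min ltr01 divr_gt0).
move: kz; rewrite lt_min => /andP[k1 k2].
set q := rational_point k in k1 k2.
have lip n : cabs (f n z - f n q) <= e / 4.
  rewrite cabsC.
  have -> : f n q = f n (z + (q - z)) by rewrite subrKC.
  apply: le_trans (local_lipschitz ef fD fB n (r := cabs z + 1) _ _) _.
  - by rewrite lerDl.
  - by rewrite (le_trans (cabsD _ _))// lerD2l ltW.
  - move: k2; rewrite ltr_pdivlMr// mulrC => k2; rewrite (le_trans _ (ltW k2))//.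
    rewrite ler_wpM2r ?cabs_ge0// (_ : cabs z + 1 + 1 = cabs z + 2) ?lerDr//.
    by ring.
have lipg : cabs (g z - g q) <= e / 2.
  apply/ler_addgt0Pr => e1 e10.
  have e12 : 0 < Num.min (e / 8) (e1 / 2) by rewrite lt_min !divr_gt0.
  have [n _ Hn] := cl [:: z; q] _ 0%N e12.
  have [|a1 _] := Hn z; first by rewrite inE eqxx.
  have [|a2 _] := Hn q; first by rewrite !inE eqxx orbT.
  move: a1 a2; rewrite !le_min => /andP[a11 a12] /andP[a21 a22].
  have -> : g z - g q = (f n z - f n q) - (f n z - g z) + (f n q - g q) by ring.
  rewrite (le_trans (cabsD _ _))// (le_trans (lerD (cabsB _ _) (lexx _)))//.
  have := lip n; lra.
have [N eN] : exists N, N.+1%:R^-1 <= e / 4.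
  exists (Num.truncn (e / 4)^-1).
  rewrite -[leRHS]invrK lef_pV2 ?posrE ?invr_gt0//.
  by rewrite ltW// truncnS_gt.
exists (maxn N k) => n; rewrite geq_max => /andP[Nn kn].
have -> : f (phi n) z - g z = (f (phi n) z - f (phi n) q) + (f (phi n) q - g q) -
  (g z - g q) by ring.
have A := phiP _ _ kn.
have {}A : cabs (f (phi n) q - g q) <= e / 4.
  by rewrite (le_trans A)// (le_trans _ eN)// lef_pV2 ?posrE// ler_nat.
rewrite (le_trans (cabsB _ _))// (le_trans (lerD (cabsD _ _) (lexx _)))//.
have := lip (phi n); lra.
Qed.

End Montel.

(** * Lebesgue measure on the plane and Gaussian integrals *)

Section Plane.
Variable R : realType.
Local Notation mu := (@lebesgue_measure R).

(** Lebesgue measure on the plane, as a measure to which Tonelli's theorem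
    applies. *)
Definition plane_measure := (mu \x mu)%E.

HB.instance Definition _ := Measure.copy plane_measure (mu \x mu)%E.

Lemma plane_measure_sigma_finite : sigma_finite setT plane_measure.
Proof.
pose I n := `[- n%:R, n%:R]%classic : set (measurableTypeR R).
have Imeas n : measurable (I n) by exact: measurable_itv.
exists (fun n => I n `*` I n).
  apply/esym; rewrite -subTset => -[x y] _.
  have big (t : R) : exists n, forall m, (n <= m)%N -> I m t.
    exists (Num.truncn `|t|).+1 => m nm.
    rewrite /I/= in_itv/= -ler_norml.
    by rewrite (le_trans (ltW (truncnS_gt _)))// ler_nat.
  have [n Hn] := big x; have [m Hm] := big y.
  by exists (maxn n m) => //; split; [apply: Hn; exact: leq_maxl|apply: Hm; exact: leq_maxr].
move=> n; split; first exact: measurableX.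
rewrite [ltLHS]product_measure1E//.
have fI : (mu (I n) < +oo)%E.
  by rewrite /I lebesgue_measure_itv/=; case: ifP => _; rewrite ?ltry.
by apply: lte_mul_pinfty => //; rewrite ge0_fin_numE.
Qed.

HB.instance Definition _ := Measure_isSigmaFinite.Build _ _ _ plane_measure
  plane_measure_sigma_finite.

Lemma cintegralE (F : R[i] -> \bar R) :
  cintegral F = (\int[plane_measure]_xy F (xy.1 +i* xy.2))%E.
Proof. by []. Qed.

Local Notation plane := (measurableTypeR R * measurableTypeR R)%type.

(** Continuous functions on the plane are measurable for the product
    sigma-algebra: an open set is a countable union of squares. *)
Lemma measurable_plane (f : R[i] -> R) :
  (forall z (e : R), 0 < e -> exists2 r : R, 0 < r &
    forall h, cabs h < r -> `|f (z + h) - f z| < e) ->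
  measurable_fun setT (fun xy : plane => f (xy.1 +i* xy.2)).
Proof.
move=> cf; apply: (measurability _ (RGenOInfty.measurableE R)).
move=> /= _ [_ [a ->]] <-; apply: measurableI => //.
set U := _ @^-1` _.
pose box k n : set plane :=
  `](complex.Re (@rational_point R k) - n.+1%:R^-1),
    (complex.Re (@rational_point R k) + n.+1%:R^-1)[%classic `*`
  `](complex.Im (@rational_point R k) - n.+1%:R^-1),
    (complex.Im (@rational_point R k) + n.+1%:R^-1)[%classic.
have mbox k n : measurable (box k n) by apply: measurableX; exact: measurable_itv.
suff -> : U = \bigcup_k \bigcup_n (if `[< box k n `<=` U >] then box k n else set0).
  apply: bigcup_measurable => k _; apply: bigcup_measurable => n _.
  by case: ifP.
apply/seteqP; split; last first.
  by move=> xy [k _ [n _]]; case: ifPn => // /asboolP; exact.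
move=> [x y]; rewrite /U/= in_itv/= andbT => fa.
have near_sym (u v w : R) : u - w < v -> v < u + w -> v - w < u < v + w.
  by move=> ? ?; apply/andP; split; lra.
have near2 (u u' v w s : R) : u - w < v -> v < u + w -> v - w < u' -> u' < v + w ->
    w < s / 4 -> `|u' - u| < s / 2.
  by move=> ? ? ? ? ?; rewrite ltr_norml; apply/andP; split; lra.
have fa0 : 0 < f (x +i* y) - a by rewrite subr_gt0.
have [r r0 Hr] := cf (x +i* y) _ fa0.
pose n := Num.truncn (4 / r).
have n0 : 0 < n.+1%:R^-1 :> R by rewrite invr_gt0.
have nr : n.+1%:R^-1 < r / 4.
  by rewrite -[ltRHS]invf_div ltf_pV2 ?posrE ?divr_gt0// truncnS_gt.
have [k kz] := rational_point_dense (x +i* y) n0.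
have := le_lt_trans (Re_le_cabs _) kz; have := le_lt_trans (Im_le_cabs _) kz.
rewrite ReD ImD ReN ImN/= !ltr_distl => /andP[k1 k2] /andP[k3 k4].
exists k => //; exists n => //; case: asboolP => [_|[]].
  by split=> /=; rewrite in_itv/=; exact: near_sym.
move=> [x' y'] [/=].
rewrite !in_itv/= andbT => /andP[h1 h2] /andP[h3 h4].
have := Hr ((x' - x) +i* (y' - y)).
have -> : x +i* y + ((x' - x) +i* (y' - y)) = x' +i* y' by simpc; rewrite !subrKC.
have c : cabs ((x' - x) +i* (y' - y)) < r.
  rewrite (le_lt_trans (cabs_pair_le _ _))//.
  rewrite [ltRHS](splitr r) ltrD//.
    exact: near2 k3 k4 h1 h2 nr.
  exact: near2 k1 k2 h3 h4 nr.
by move=> /(_ c); rewrite ltr_distl => /andP[+ _]; rewrite subKr.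
Qed.

Lemma measurable_plane_entire (f : R[i] -> R[i]) : entire f ->
  [/\ measurable_fun setT (fun xy : plane => complex.Re (f (xy.1 +i* xy.2))),
     measurable_fun setT (fun xy : plane => complex.Im (f (xy.1 +i* xy.2))) &
     measurable_fun setT (fun xy : plane => cabs (f (xy.1 +i* xy.2)))].
Proof.
move=> /entireP ef; split.
- apply: (@measurable_plane (fun z => complex.Re (f z))) => z e e0.
  have [d hd] := ef z; have [r r0 Hr] := cdiff_continuous hd e0.
  by exists r => // h /Hr; rewrite -ReN -ReD; exact: le_lt_trans (Re_le_cabs _).
- apply: (@measurable_plane (fun z => complex.Im (f z))) => z e e0.
  have [d hd] := ef z; have [r r0 Hr] := cdiff_continuous hd e0.
  by exists r => // h /Hr; rewrite -ImN -ImD; exact: le_lt_trans (Im_le_cabs _).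
- apply: (@measurable_plane (fun z => cabs (f z))) => z e e0.
  have [d hd] := ef z; have [r r0 Hr] := cdiff_continuous hd e0.
  exists r => // h /Hr; apply: le_lt_trans.
  rewrite ler_norml; apply/andP; split.
    rewrite -subr_ge0 opprK; have := cabsB (f (z + h)) (f (z + h) - f z).
    by rewrite subKr; lra.
  by have := cabsD (f z) (f (z + h) - f z); rewrite subrKC; lra.
Qed.

Lemma measurable_plane_gauss (c : R) :
  measurable_fun setT (fun xy : plane => expR (c * cabs (xy.1 +i* xy.2) ^+ 2)).
Proof.
apply: measurableT_comp => //; apply: measurable_funM => //.
by apply: measurable_funX; have [] := measurable_plane_entire entire_id.
Qed.

Lemma gauss_line (c : R) : 0 < c -> exists2 K : R, 0 < K &
  forall m : R, (\int[mu]_x (expR (- c * (x - m) ^+ 2))%:E = K%:E)%E.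
Proof.
move=> c0; pose s := Num.sqrt (2 * c)^-1.
have c20 : 0 < (2 * c)^-1 by rewrite invr_gt0 mulr_gt0.
have s0 : s != 0 by rewrite gt_eqF// sqrtr_gt0.
have p0 := normal_peak_gt0 s0.
exists (normal_peak s)^-1 => [|m]; first by rewrite invr_gt0.
have E x : (expR (- c * (x - m) ^+ 2))%:E =
    ((normal_peak s)^-1%:E * (normal_pdf m s x)%:E)%E.
  rewrite -EFinM normal_pdfE// mulKf ?gt_eqF// /normal_fun sqr_sqrtr ?ltW//.
  by congr (expR _)%:E; field; rewrite gt_eqF.
under eq_integral do rewrite E.
rewrite ge0_integralZl_EFin//.
- by rewrite integral_normal_pdf mule1.
- by move=> x _; rewrite lee_fin normal_pdf_ge0.
- by apply/measurable_EFinP; exact: measurable_normal_pdf.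
- by rewrite invr_ge0 ltW.
Qed.

(** The integral over the plane of a Gaussian does not depend on its centre. *)
Lemma gauss_plane (c : R) : 0 < c -> exists2 K : R, 0 < K &
  forall a : R[i], cintegral (fun w => (expR (- c * cabs (w - a) ^+ 2))%:E) = K%:E.
Proof.
move=> c0; have [K K0 KE] := gauss_line c0.
exists (K * K) => [|[a b]]; first by rewrite mulr_gt0.
have E (x y : R) : expR (- c * cabs ((x +i* y) - (a +i* b)) ^+ 2) =
    expR (- c * (x - a) ^+ 2) * expR (- c * (y - b) ^+ 2).
  by rewrite sqr_cabs/= -expRD -mulrDr.
rewrite /cintegral.
under eq_integral do rewrite E.
rewrite fubini_tonelli1/=; last 2 first.
- apply/measurable_EFinP; apply: measurable_funM; apply: measurableT_comp => //;
    apply: measurable_funM => //; apply: measurable_funX;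
    exact: measurable_funB.
- by move=> x; rewrite lee_fin mulr_ge0 ?expR_ge0.
rewrite /fubini_F/=.
have line (k m : R) : 0 <= k ->
    (\int[mu]_x (k * expR (- c * (x - m) ^+ 2))%:E = (k * K)%:E)%E.
  move=> k0; under eq_integral do rewrite EFinM.
  rewrite ge0_integralZl_EFin//; first by rewrite KE.
  apply/measurable_EFinP; apply: measurableT_comp => //.
  by apply: measurable_funM => //; apply: measurable_funX; exact: measurable_funB.
under eq_integral => x _ do rewrite line ?expR_ge0// mulrC.
by rewrite line ?ltW.
Qed.

End Plane.
Arguments plane_measure R : clear implicits.

(** * The kernel integral and the upper bound *)

Section Symbol.
Variables (R : realType) (alpha p : R).
Hypotheses (alpha_gt0 : 0 < alpha) (p_gt0 : 0 < p).
Implicit Types (u psi f : R[i] -> R[i]).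
Local Notation plane := (measurableTypeR R * measurableTypeR R)%type.

(** The integrand and the integral which govern [uC_psi] on the Fock space of
    exponent infinity: [|u|^p exp ((p alpha / 2) (|psi|^2 - |z|^2))]. *)
Definition symbol_weight u psi (z : R[i]) : R :=
  cabs (u z) `^ p * expR (p * alpha / 2 * (cabs (psi z) ^+ 2 - cabs z ^+ 2)).

Definition symbol_integral u psi : \bar R :=
  cintegral (fun z => (symbol_weight u psi z)%:E).

(** The integral which defines the Fock norm of finite exponent. *)
Definition fock_integral f : \bar R :=
  cintegral (fun z => (cabs (f z) `^ p * expR (- (alpha * p / 2) * cabs z ^+ 2))%:E).

Lemma symbol_weight_ge0 u psi z : 0 <= symbol_weight u psi z.
Proof. by rewrite mulr_ge0 ?powR_ge0 ?expR_ge0. Qed.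

Lemma cintegral_ge0 (F : R[i] -> R) : (forall z, 0 <= F z) ->
  (0 <= cintegral (fun z => (F z)%:E))%E.
Proof. by move=> F0; apply: integral_ge0 => z _; rewrite lee_fin. Qed.

Lemma symbol_integral_ge0 u psi : (0 <= symbol_integral u psi)%E.
Proof. by apply: cintegral_ge0 => z; exact: symbol_weight_ge0. Qed.

Lemma fock_integral_ge0 f : (0 <= fock_integral f)%E.
Proof. by apply: cintegral_ge0 => z; rewrite mulr_ge0 ?powR_ge0 ?expR_ge0. Qed.

Lemma measurable_symbol_weight u psi : entire u -> entire psi ->
  measurable_fun setT (fun xy : plane => symbol_weight u psi (xy.1 +i* xy.2)).
Proof.
move=> eu ep; apply: measurable_funM.
  apply: (measurableT_comp (measurable_powR p)).
  by have [] := measurable_plane_entire eu.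
apply: measurableT_comp => //; apply: measurable_funM => //.
apply: measurable_funB; apply: measurable_funX.
  by have [] := measurable_plane_entire ep.
by have [] := measurable_plane_entire (@entire_id R).
Qed.

Lemma measurable_fock_integrand f : entire f ->
  measurable_fun setT (fun xy : plane => cabs (f (xy.1 +i* xy.2)) `^ p *
    expR (- (alpha * p / 2) * cabs (xy.1 +i* xy.2) ^+ 2)).
Proof.
move=> ef; apply: measurable_funM; last exact: measurable_plane_gauss.
apply: (measurableT_comp (measurable_powR p)).
by have [] := measurable_plane_entire ef.
Qed.

Lemma kernel_integrandE u psi w z :
  cabs (fock_kernel alpha w (psi z) * u z) `^ p *
    expR (- (p * alpha / 2) * cabs z ^+ 2) =
  symbol_weight u psi z * expR (- (p * alpha / 2) * cabs (w - psi z) ^+ 2).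
Proof.
rewrite /fock_kernel cabsM cabs_cexp powRM ?expR_ge0 ?cabs_ge0// -expRM.
rewrite /symbol_weight [expR _ * _]mulrC -[LHS]mulrA -[RHS]mulrA -!expRD; congr (_ * expR _).
rewrite !sqr_cabs; case: (psi z) w => a b [c d] /=.
by case: z => x y /=; field.
Qed.

(** Tonelli: integrating the kernel in [w] first leaves a Gaussian centred at
    [psi z], whose integral does not depend on [z]. *)
Lemma kernel_integralE : exists2 K : R, 0 < K & forall u psi, entire u -> entire psi ->
  kernel_integral alpha p u psi = (K%:E * symbol_integral u psi)%E.
Proof.
have c0 : 0 < p * alpha / 2 by rewrite divr_gt0// mulr_gt0.
have [K K0 KE] := gauss_plane c0.
exists K => // u psi eu ep.
pose F (q : plane * plane) : \bar R := (symbol_weight u psi (q.2.1 +i* q.2.2) *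
  expR (- (p * alpha / 2) * cabs (q.1.1 +i* q.1.2 - psi (q.2.1 +i* q.2.2)) ^+ 2))%:E.
have [mre mim _] := measurable_plane_entire ep.
have mF : measurable_fun setT F.
  apply/measurable_EFinP; apply: measurable_funM.
    exact: (measurableT_comp (measurable_symbol_weight eu ep) measurable_snd).
  apply: measurableT_comp => //; apply: measurable_funM => //.
  rewrite (_ : (fun q : plane * plane => _) = (fun q : plane * plane =>
    (q.1.1 - complex.Re (psi (q.2.1 +i* q.2.2))) ^+ 2 +
    (q.1.2 - complex.Im (psi (q.2.1 +i* q.2.2))) ^+ 2)); last first.
    by apply/funext => q; rewrite sqr_cabs ReD ImD ReN ImN.
  apply: measurable_funD; apply: measurable_funX; apply: measurable_funB.
  - exact: (measurableT_comp measurable_fst measurable_fst).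
  - exact: (measurableT_comp mre measurable_snd).
  - exact: (measurableT_comp measurable_snd measurable_fst).
  - exact: (measurableT_comp mim measurable_snd).
have F0 q : (0 <= F q)%E by rewrite lee_fin mulr_ge0 ?symbol_weight_ge0 ?expR_ge0.
have -> : kernel_integral alpha p u psi =
    (\int[plane_measure R]_w \int[plane_measure R]_z F (w, z))%E.
  apply: eq_integral => w _; apply: eq_integral => z _.
  by rewrite kernel_integrandE.
rewrite (@fubini_tonelli _ _ _ _ _ (plane_measure R) (plane_measure R) F mF F0).
rewrite /F/=.
have inner z : (\int[plane_measure R]_xy (symbol_weight u psi z *
    expR (- (p * alpha / 2) * cabs (xy.1 +i* xy.2 - psi z) ^+ 2))%:E =
    K%:E * (symbol_weight u psi z)%:E)%E.
  under eq_integral do rewrite EFinM.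
  rewrite ge0_integralZl_EFin ?symbol_weight_ge0//.
    rewrite -(cintegralE (fun w =>
      (expR (- (p * alpha / 2) * cabs (w - psi z) ^+ 2))%:E)).
    by rewrite KE muleC.
  apply/measurable_EFinP; apply: measurableT_comp => //; apply: measurable_funM => //.
  apply: measurable_funX.
  by have [] := measurable_plane_entire (entireB (@entire_id R) (entire_cst (psi z))).
under eq_integral do rewrite inner.
rewrite ge0_integralZl_EFin//.
- by move=> z _; rewrite lee_fin symbol_weight_ge0.
- by apply/measurable_EFinP; exact: measurable_symbol_weight.
- exact: ltW.
Qed.

Lemma fock_const_gt0 : 0 < alpha * p / (2 * pi).
Proof. by rewrite divr_gt0 ?mulr_gt0 ?pi_gt0. Qed.

Lemma fock_normE f :
  fock_norm alpha p%:E f = (((alpha * p / (2 * pi))%:E * fock_integral f) `^ p^-1)%E.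
Proof. by []. Qed.

Lemma poweRVK (x : \bar R) : (0 <= x)%E -> ((x `^ p^-1) `^ p = x)%E.
Proof. by move=> x0; rewrite -poweRrM mulVf ?gt_eqF// poweRe1. Qed.

Lemma le_poweR (x y : \bar R) (r : R) : 0 <= r -> (0 <= x)%E -> (x <= y)%E ->
  (x `^ r <= y `^ r)%E.
Proof.
move=> r0 x0 xy; apply: gt0_ler_poweR => //.
  by rewrite in_itv/= x0 leey.
by rewrite in_itv/= leey (le_trans x0 xy).
Qed.

Lemma fock_norm_pow f : (fock_norm alpha p%:E f `^ p =
  (alpha * p / (2 * pi))%:E * fock_integral f)%E.
Proof.
rewrite fock_normE poweRVK// mule_ge0 ?fock_integral_ge0// lee_fin.
exact/ltW/fock_const_gt0.
Qed.

Lemma fock_norm_sup_le f (M : R) : (fock_norm alpha +oo f <= M%:E)%E <->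
  forall z, cabs (f z) <= M * expR (alpha / 2 * cabs z ^+ 2).
Proof.
have E z : (cabs (f z) <= M * expR (alpha / 2 * cabs z ^+ 2)) =
    (cabs (f z) * expR (- (alpha / 2) * cabs z ^+ 2) <= M).
  by rewrite mulNr expRN ler_pdivrMr ?expR_gt0.
split=> [H z|H].
  rewrite E -lee_fin; apply: le_trans H; apply: ereal_sup_ubound.
  by exists z.
by apply: ge_ereal_sup => _ [z _ <-]; rewrite lee_fin -E.
Qed.

Lemma fock_norm_sup_ge0 f : (0 <= fock_norm alpha +oo f)%E.
Proof.
apply: (@le_trans _ _ (cabs (f 0) * expR (- (alpha / 2) * cabs (0 : R[i]) ^+ 2))%:E).
  by rewrite lee_fin mulr_ge0 ?cabs_ge0 ?expR_ge0.
by apply: ereal_sup_ubound; exists 0.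
Qed.

Lemma fock_sup_bound f : fock alpha +oo f -> exists2 M : R,
  fock_norm alpha +oo f = M%:E &
  0 <= M /\ forall z, cabs (f z) <= M * expR (alpha / 2 * cabs z ^+ 2).
Proof.
move=> [_ fin]; have n0 := fock_norm_sup_ge0 f.
exists (fine (fock_norm alpha +oo f)).
  by rewrite fineK// ge0_fin_numE.
split; first exact: fine_ge0.
by apply/fock_norm_sup_le; rewrite fineK ?ge0_fin_numE.
Qed.

Lemma wcomp_integrand_le u psi f (M : R) z : 0 <= M ->
  (forall z, cabs (f z) <= M * expR (alpha / 2 * cabs z ^+ 2)) ->
  cabs (wcomp u psi f z) `^ p * expR (- (alpha * p / 2) * cabs z ^+ 2) <=
  M `^ p * symbol_weight u psi z.
Proof.
move=> M0 fM; rewrite /symbol_weight mulrBr expRB mulrA.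
rewrite (_ : expR (- (alpha * p / 2) * cabs z ^+ 2) =
   (expR (p * alpha / 2 * cabs z ^+ 2))^-1); last first.
  by rewrite -expRN; congr expR; ring.
rewrite mulrA ler_wpM2r ?invr_ge0 ?expR_ge0//.
rewrite /wcomp cabsM powRM ?cabs_ge0//.
rewrite [leRHS](_ : _ = cabs (u z) `^ p *
  (M `^ p * expR (p * alpha / 2 * cabs (psi z) ^+ 2))); last by ring.
rewrite ler_wpM2l ?powR_ge0//.
have -> : expR (p * alpha / 2 * cabs (psi z) ^+ 2) =
    expR (alpha / 2 * cabs (psi z) ^+ 2) `^ p.
  by rewrite -expRM; congr expR; ring.
rewrite -powRM ?expR_ge0// ge0_ler_powR ?nnegrE ?cabs_ge0 ?(ltW p_gt0)//.
by rewrite mulr_ge0 ?expR_ge0.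
Qed.

Lemma entire_wcomp u psi f : entire u -> entire psi -> entire f ->
  entire (wcomp u psi f).
Proof. by move=> eu ep ef; exact: (entireM eu (entire_comp ef ep)). Qed.

Lemma fock_integral_wcomp_le u psi f (M : R) : entire u -> entire psi -> entire f ->
  0 <= M -> (forall z, cabs (f z) <= M * expR (alpha / 2 * cabs z ^+ 2)) ->
  (fock_integral (wcomp u psi f) <= (M `^ p)%:E * symbol_integral u psi)%E.
Proof.
move=> eu ep ef M0 fM.
have mW := measurable_symbol_weight eu ep.
have mWE : measurable_fun setT
    (fun xy : plane => (symbol_weight u psi (xy.1 +i* xy.2))%:E).
  by apply/measurable_EFinP; exact: mW.
have W0 (xy : plane) : setT xy -> (0 <= (symbol_weight u psi (xy.1 +i* xy.2))%:E)%E.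
  by rewrite lee_fin symbol_weight_ge0.
rewrite /symbol_integral cintegralE.
rewrite -(ge0_integralZl_EFin (plane_measure R) measurableT W0 mWE (powR_ge0 M p)).
apply: ge0_le_integral => //.
- by move=> z _; rewrite lee_fin mulr_ge0 ?powR_ge0 ?expR_ge0.
- have hf := measurable_fock_integrand (entire_wcomp eu ep ef).
  by apply/measurable_EFinP; exact: hf.
- exact: (measurable_funeM _ mWE).
- by move=> z _; rewrite -EFinM lee_fin wcomp_integrand_le.
Qed.

Lemma opnorm_pow_le u psi : entire u -> entire psi ->
  (fock_opnorm alpha +oo p%:E (wcomp u psi) `^ p <=
   (alpha * p / (2 * pi))%:E * symbol_integral u psi)%E.
Proof.
move=> eu ep.
have C0 := fock_const_gt0.
have CJ0 : (0 <= (alpha * p / (2 * pi))%:E * symbol_integral u psi)%E.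
  by rewrite mule_ge0 ?symbol_integral_ge0// lee_fin ltW.
rewrite -[leRHS]poweRVK//; apply: le_poweR; first exact: ltW.
  apply: (@le_trans _ _ (fock_norm alpha p%:E (wcomp u psi (fun=> 0%R)))).
    by rewrite fock_normE poweR_ge0.
  have n0 : (fock_norm alpha +oo (fun=> 0%R : R[i]) <= 0%:E)%E.
    by apply/fock_norm_sup_le => z; rewrite cabs0 mul0r.
  have z0 : fock alpha +oo (fun=> 0%R : R[i]).
    by split; [exact: (entire_cst 0%R)|rewrite (le_lt_trans n0)// ltry].
  apply: ereal_sup_ubound; exists (fun=> 0%R); last exact: erefl.
  by split; [exact: z0|rewrite (le_trans n0)// lee_fin].
apply: ge_ereal_sup => _ [f [[ef _] f1] <-].
rewrite fock_normE; apply: le_poweR; first by rewrite invr_ge0 ltW.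
  by rewrite mule_ge0 ?fock_integral_ge0// lee_fin ltW.
rewrite lee_wpmul2l ?lee_fin ?(ltW C0)//.
have := fock_integral_wcomp_le eu ep ef ler01 ((fock_norm_sup_le f 1).1 f1).
by rewrite powR1 mul1e.
Qed.

End Symbol.

(** * Signed sums of waves *)

Section Signs.
Variable R : realType.

(** The sign, 1 or -1, encoded by a boolean. *)
Definition sign_of (b : bool) : R[i] := if b then 1 else -1.

Lemma cabs_sign_of b : cabs (sign_of b) = 1.
Proof. by rewrite /sign_of; case: b; rewrite ?cabsN cabs1. Qed.

Lemma powR_max_le (p a b c : R) : 0 < p -> 0 <= a -> 0 <= b -> 0 <= c ->
  2 * c <= a + b -> c `^ p <= a `^ p + b `^ p.
Proof.
move=> p0 a0 b0 c0 cab.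
have [ca|ac] := leP c a.
  by rewrite (@le_trans _ _ (a `^ p)) ?lerDl ?powR_ge0// ge0_ler_powR ?nnegrE// ltW.
rewrite (@le_trans _ _ (b `^ p)) ?lerDr ?powR_ge0// ge0_ler_powR ?nnegrE//; first exact: ltW.
lra.
Qed.

(** A lower Khinchine inequality, for every exponent: a random signed sum is
    on average at least as large as half of each of its terms, as one sees by
    flipping the sign of that term. *)
Lemma random_signs (n : nat) (p : R) (c : 'I_n -> R[i]) (i0 : 'I_n) : 0 < p ->
  (2 ^ n)%:R * cabs (c i0) `^ p <=
  2 * \sum_(e : {ffun 'I_n -> bool}) cabs (\sum_(i < n) sign_of (e i) * c i) `^ p.
Proof.
move=> p0.
pose flip (e : {ffun 'I_n -> bool}) := [ffun i => if i == i0 then ~~ e i else e i].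
have flipK : involutive flip.
  move=> e; apply/ffunP => i; rewrite !ffunE; case: eqP => //.
  by rewrite negbK.
pose S (e : {ffun 'I_n -> bool}) := \sum_(i < n) sign_of (e i) * c i.
have pair e : cabs (c i0) `^ p <= cabs (S e) `^ p + cabs (S (flip e)) `^ p.
  apply: powR_max_le; rewrite ?cabs_ge0//.
  (* The two sums differ by twice the flipped term. *)
  have E : S e - S (flip e) = 2 * (sign_of (e i0) * c i0).
    rewrite /S !(bigD1 i0 (P := predT))//= ffunE eqxx.
    rewrite (eq_bigr (fun i => sign_of (e i) * c i) (P := fun i => i != i0)
      (F1 := fun i => sign_of (flip e i) * c i)); last first.
      by move=> i /negbTE ii; rewrite ffunE ii.
    by case: (e i0); rewrite /sign_of/=; ring.
  have := cabsB (S e) (S (flip e)); rewrite E !cabsM cabs_sign_of mul1r.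
  by have := cabs_real (2 : R); rewrite ger0_norm// => <-; rewrite rmorph_nat.
have -> : 2 * \sum_(e : {ffun 'I_n -> bool}) cabs (S e) `^ p =
    \sum_(e : {ffun 'I_n -> bool}) (cabs (S e) `^ p + cabs (S (flip e)) `^ p).
  rewrite big_split/= mulr_natl mulr2n; congr (_ + _).
  exact: (reindex_inj (inv_inj flipK)).
apply: (@le_trans _ _ (\sum_(e : {ffun 'I_n -> bool}) cabs (c i0) `^ p)).
  by rewrite sumr_const card_ffun card_bool card_ord mulr_natl.
by apply: ler_sum => e _.
Qed.

End Signs.

Section Packets.
Variables (R : realType) (alpha : R).
Hypothesis alpha_gt0 : 0 < alpha.

(** An entire function with modulus [exp ((alpha / 2) |z|^2)] times a Gaussian
    in [Im z] centred at [s]. *)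
Definition wave (s : R) (z : R[i]) : R[i] :=
  cexp ((alpha / 2)%:C * (z * z) - (2 * alpha * s)%:C * ('i%C * z) -
        (alpha * s ^+ 2)%:C).

Lemma entire_wave s : entire (wave s).
Proof.
have e1 : entire (fun z : R[i] => z * z) by exact: (entireM entire_id entire_id).
have e2 : entire (fun z : R[i] => (alpha / 2)%:C * (z * z)).
  exact: (entireZ (alpha / 2)%:C e1).
have e3 : entire (fun z : R[i] => (2 * alpha * s)%:C * ('i%C * z)).
  exact: (entireZ (2 * alpha * s)%:C (entireZ 'i%C entire_id)).
have e4 := entireB (entireB e2 e3) (entire_cst (alpha * s ^+ 2)%:C).
exact: (entire_comp entire_cexp e4).
Qed.

Lemma cabs_wave s z : cabs (wave s z) =
  expR (- alpha * (complex.Im z - s) ^+ 2) * expR (alpha / 2 * cabs z ^+ 2).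
Proof.
rewrite /wave cabs_cexp -expRD sqr_cabs; congr expR.
by case: z => x y /=; field.
Qed.

(** [exp (- alpha x^2)] is dominated by the increments of the bounded function
    [x / (1 + |x|)], so that its sums over arithmetic progressions of step 1
    are uniformly bounded. *)
Definition squash (x : R) : R := x / (1 + `|x|).

Lemma squash_bound x : `|squash x| <= 1.
Proof.
have h : 0 < 1 + `|x| by rewrite ltr_wpDr.
by rewrite normrM normfV (gtr0_norm h) ler_pdivrMr// mul1r lerDr.
Qed.

Lemma squash_step x : 1 <= 4 * (1 + x ^+ 2) * (squash (x + 1) - squash x).
Proof.
rewrite /squash.
have D (a b t : R) : 0 < a -> 0 < b -> a * b <= t * ((x + 1) * b - x * a) ->
    1 <= t * ((x + 1) / a - x / b).
  move=> a0 b0 H.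
  have -> : (x + 1) / a - x / b = ((x + 1) * b - x * a) / (a * b).
    by field; rewrite !gt_eqF.
  by rewrite mulrA ler_pdivlMr ?mulr_gt0// mul1r.
have p1 : 0 < 1 + `|x + 1| by rewrite ltr_wpDr.
have p2 : 0 < 1 + `|x| by rewrite ltr_wpDr.
apply: D => //.
have [x0|x0] := leP 0 x.
  rewrite !ger0_norm//; last by lra.
  nra.
have [x1|x1] := leP (-1) x.
  rewrite (ltr0_norm x0) ger0_norm; last by lra.
  nra.
rewrite !ltr0_norm//; last by lra.
nra.
Qed.

(** A bound for the sums of [exp (- alpha x^2)] along progressions of step 1:
    the total increment of [squash] is at most 2, and each term is at most
    [4 (1 + 1 / alpha)] times an increment. *)
Definition packet_bound : R := 8 * (1 + alpha^-1).

Lemma packet_bound_gt0 : 0 < packet_bound.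
Proof. by rewrite mulr_gt0// addr_gt0// invr_gt0. Qed.

Lemma gauss_step x :
  expR (- alpha * x ^+ 2) <= packet_bound / 2 * (squash (x + 1) - squash x).
Proof.
have x2 := sqr_ge0 x.
have a1 : 0 < 1 + alpha * x ^+ 2 by rewrite ltr_wpDr// mulr_ge0// ltW.
apply: (@le_trans _ _ (1 + alpha * x ^+ 2)^-1).
  by rewrite mulNr expRN lef_pV2 ?posrE ?expR_gt0// expR_ge1Dx.
rewrite -[leLHS]mul1r ler_pdivrMr//.
apply: le_trans (squash_step x) _.
have s0 : 0 <= squash (x + 1) - squash x.
  by rewrite -(@pmulr_rge0 _ (4 * (1 + x ^+ 2))) ?(le_trans ler01 (squash_step x))//; lra.
have -> : packet_bound / 2 * (squash (x + 1) - squash x) * (1 + alpha * x ^+ 2) =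
  4 * ((1 + alpha^-1) * (1 + alpha * x ^+ 2)) * (squash (x + 1) - squash x).
  by rewrite /packet_bound; field; rewrite gt_eqF.
rewrite ler_wpM2r// ler_wpM2l//.
have -> : (1 + alpha^-1) * (1 + alpha * x ^+ 2) =
  1 + x ^+ 2 + (alpha^-1 + alpha * x ^+ 2) by field; rewrite gt_eqF.
by rewrite lerDl addr_ge0//; [rewrite invr_ge0 ltW|rewrite mulr_ge0// ltW].
Qed.

Lemma gauss_sum (n : nat) (a : R) :
  \sum_(i < n) expR (- alpha * (a - i%:R) ^+ 2) <= packet_bound.
Proof.
apply: (@le_trans _ _ (\sum_(i < n)
    packet_bound / 2 * (squash (i.+1%:R - a) - squash (i%:R - a)))).
  apply: ler_sum => i _; rewrite (_ : (a - i%:R) ^+ 2 = (i%:R - a) ^+ 2); last by ring.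
  apply: le_trans (gauss_step _) _.
  by rewrite (_ : i%:R - a + 1 = i.+1%:R - a)// -natr1; ring.
rewrite -mulr_sumr -(big_mkord predT (fun i => squash (i.+1%:R - a) - squash (i%:R - a))).
rewrite (telescope_sumr (fun i => squash (i%:R - a)))//.
have := squash_bound (n%:R - a); have := squash_bound (0%:R - a).
rewrite !ler_norml => /andP[h1 h2] /andP[h3 h4].
rewrite [leRHS](_ : _ = packet_bound / 2 * 2); last by rewrite divfK.
rewrite ler_wpM2l//; last by lra.
by rewrite divr_ge0// ltW// packet_bound_gt0.
Qed.

(** Signed sums of waves centred at the integers of [- N, N], normalized so
    as to lie in the unit ball of the Fock space of exponent infinity. *)
Definition packet (N : nat) (e : {ffun 'I_(N.*2.+1) -> bool}) (z : R[i]) : R[i] :=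
  (packet_bound^-1)%:C *
  \sum_(i < N.*2.+1) sign_of R (e i) * wave (i%:R - N%:R) z.

Lemma entire_packet N (e : {ffun 'I_(N.*2.+1) -> bool}) : entire (packet e).
Proof.
apply: (entireZ (packet_bound^-1)%:C).
apply: (entire_sum _ (F := fun i z => sign_of R (e i) * wave (i%:R - N%:R) z)).
by move=> i; exact: (entireZ (sign_of R (e i)) (@entire_wave (i%:R - N%:R))).
Qed.

Lemma packet_le N (e : {ffun 'I_(N.*2.+1) -> bool}) z :
  cabs (packet e z) <= 1 * expR (alpha / 2 * cabs z ^+ 2).
Proof.
have b0 := packet_bound_gt0.
rewrite /packet cabsM cabs_real ger0_norm ?invr_ge0 ?(ltW b0)// ler_pdivrMl//.
apply: le_trans (cabs_sum _ _) _.
rewrite (eq_bigr (fun i : 'I_(N.*2.+1) =>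
  expR (- alpha * ((complex.Im z + N%:R) - i%:R) ^+ 2) *
  expR (alpha / 2 * cabs z ^+ 2))); last first.
  move=> i _; rewrite cabsM cabs_sign_of mul1r cabs_wave; congr (expR _ * _).
  by ring.
by rewrite -mulr_suml mul1r ler_wpM2r ?expR_ge0// gauss_sum.
Qed.

(** The constant of [packet_average]: 2 comes from [random_signs],
    [packet_bound] from the normalization of the packets, and [exp alpha] from
    the distance, at most 1, to the centre of the nearest wave. *)
Definition packet_const (p : R) : R := 2 * (packet_bound * expR alpha) `^ p.

(** In the strip where [|Im z| <= N], the average over the signs of
    [|packet|^p] is comparable to [exp ((p alpha / 2) |z|^2)]. *)
Lemma packet_average (N : nat) (p : R) z : 0 < p -> `|complex.Im z| <= N%:R ->
  (2 ^ N.*2.+1)%:R * expR (p * alpha / 2 * cabs z ^+ 2) <=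
  packet_const p * \sum_(e : {ffun 'I_(N.*2.+1) -> bool}) cabs (packet e z) `^ p.
Proof.
move=> p0; rewrite ler_norml => /andP[y1 y2].
have b0 := packet_bound_gt0.
(* The wave of index [k] is centred at [k - N], within 1 of [Im z]. *)
have yN : 0 <= complex.Im z + N%:R by lra.
have /andP[k1 k2] := truncn_itv yN.
set k := Num.truncn _ in k1 k2.
have kN : (k < N.*2.+1)%N.
  rewrite ltnS -(ler_nat R) (le_trans k1)// -mul2n natrM; lra.
pose i0 := Ordinal kN.
have := @random_signs R N.*2.+1 p
  (fun i => (packet_bound^-1)%:C * wave (i%:R - N%:R) z) i0 p0.
rewrite (eq_bigr (fun e : {ffun 'I_(N.*2.+1) -> bool} => cabs (packet e z) `^ p)); last first.
  move=> e _; congr (cabs _ `^ _); rewrite /packet mulr_sumr; apply: eq_bigr => i _.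
  by rewrite mulrCA.
set S := \sum_(e : _) _ => H.
have BE0 : 0 <= packet_bound * expR alpha.
  by apply: mulr_ge0; [exact: ltW|exact: expR_ge0].
have low : expR (p * alpha / 2 * cabs z ^+ 2) <=
   (packet_bound * expR alpha) `^ p *
   cabs ((packet_bound^-1)%:C * wave (i0%:R - N%:R) z) `^ p.
  rewrite -powRM ?cabs_ge0//.
  rewrite (_ : p * alpha / 2 * cabs z ^+ 2 = alpha / 2 * cabs z ^+ 2 * p); last by ring.
  rewrite expRM ge0_ler_powR ?nnegrE ?expR_ge0 ?(ltW p0)//.
    by apply: mulr_ge0; [apply: mulr_ge0; [exact: ltW|exact: expR_ge0]|exact: cabs_ge0].
  rewrite cabsM cabs_real ger0_norm ?invr_ge0 ?(ltW b0)// cabs_wave /=.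
  rewrite [leRHS]mulrACA divff ?gt_eqF// mul1r [leRHS]mulrA -expRD.
  rewrite ler_peMl ?expR_ge0// -[leLHS]expR0 ler_expR.
  have -> : alpha + - alpha * (complex.Im z - (k%:R - N%:R)) ^+ 2 =
     alpha * (1 - (complex.Im z + N%:R - k%:R) ^+ 2) by ring.
  rewrite mulr_ge0 ?(ltW alpha_gt0)// subr_ge0.
  rewrite -natr1 in k2.
  by rewrite expr_le1//; lra.
apply: le_trans (ler_wpM2l (ler0n _ _) low) _.
rewrite /packet_const mulrCA [leRHS](_ : _ = (packet_bound * expR alpha) `^ p * (2 * S)).
  by rewrite ler_wpM2l ?powR_ge0.
by rewrite -mulrA mulrCA.
Qed.

End Packets.
Arguments entire_packet {R} alpha {N} e z.

(** * The lower bound *)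

Section LowerBound.
Variables (R : realType) (alpha p : R).
Hypotheses (alpha_gt0 : 0 < alpha) (p_gt0 : 0 < p).
Implicit Types (u psi : R[i] -> R[i]).
Local Notation plane := (measurableTypeR R * measurableTypeR R)%type.
Local Notation C0 := (alpha * p / (2 * pi) : R).

Lemma fock_norm_packet_le1 N (e : {ffun 'I_(N.*2.+1) -> bool}) :
  fock alpha +oo (packet alpha e) /\ (fock_norm alpha +oo (packet alpha e) <= 1)%E.
Proof.
have n1 : (fock_norm alpha +oo (packet alpha e) <= 1%:E)%E.
  by apply/fock_norm_sup_le => z; exact: packet_le.
split; last exact: n1.
by split; [exact: entire_packet|exact: le_lt_trans n1 (ltry _)].
Qed.

Lemma fock_integral_packet_le u psi N (e : {ffun 'I_(N.*2.+1) -> bool}) :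
  (fock_integral alpha p (wcomp u psi (packet alpha e)) <=
   C0^-1%:E * fock_opnorm alpha +oo p%:E (wcomp u psi) `^ p)%E.
Proof.
have c0 := fock_const_gt0 alpha_gt0 p_gt0.
have [h1 h2] := fock_norm_packet_le1 e.
rewrite muleC lee_pdivlMr// muleC -fock_norm_pow//.
apply: le_poweR; [exact: ltW|by rewrite fock_normE poweR_ge0|].
by apply: ereal_sup_ubound; exists (packet alpha e); [split; [exact: h1|exact: h2]|exact: erefl].
Qed.

Lemma symbol_weight_le_packets u psi N z : `|complex.Im (psi z)| <= N%:R ->
  symbol_weight alpha p u psi z <=
  \sum_(e : {ffun 'I_(N.*2.+1) -> bool})
    packet_const alpha p / (2 ^ N.*2.+1)%:R *
    (cabs (wcomp u psi (packet alpha e) z) `^ p *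
     expR (- (alpha * p / 2) * cabs z ^+ 2)).
Proof.
move=> yN; have A := packet_average alpha_gt0 p_gt0 yN.
have n0 : 0 < (2 ^ N.*2.+1)%:R :> R by rewrite ltr0n expn_gt0.
rewrite -mulr_sumr mulrAC ler_pdivlMr// mulrC.
have -> : \sum_(e : {ffun 'I_(N.*2.+1) -> bool})
    (cabs (wcomp u psi (packet alpha e) z) `^ p *
     expR (- (alpha * p / 2) * cabs z ^+ 2)) =
   (cabs (u z) `^ p * expR (- (alpha * p / 2) * cabs z ^+ 2)) *
   \sum_(e : {ffun 'I_(N.*2.+1) -> bool}) cabs (packet alpha e (psi z)) `^ p.
  rewrite mulr_sumr; apply: eq_bigr => e _.
  by rewrite /wcomp cabsM powRM ?cabs_ge0// mulrAC.
rewrite /symbol_weight mulrBr expRD.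
rewrite (_ : - (p * alpha / 2 * cabs z ^+ 2) = - (alpha * p / 2) * cabs z ^+ 2); last by ring.
rewrite [leLHS](_ : _ = (cabs (u z) `^ p * expR (- (alpha * p / 2) * cabs z ^+ 2)) *
  ((2 ^ N.*2.+1)%:R * expR (p * alpha / 2 * cabs (psi z) ^+ 2))); last by ring.
rewrite [leRHS]mulrCA ler_wpM2l// mulr_ge0 ?powR_ge0 ?expR_ge0//.
Qed.

(** The lower bound of the norm on a strip; the average over the signs is taken
    inside the integral. *)
Lemma symbol_integral_strip_le u psi N (X : R) : entire u -> entire psi ->
  (fock_opnorm alpha +oo p%:E (wcomp u psi) `^ p)%E = X%:E ->
  (\int[plane_measure R]_(xy in [set xy | (`|complex.Im (psi (xy.1 +i* xy.2))| <= N%:R)%R])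
     (symbol_weight alpha p u psi (xy.1 +i* xy.2))%:E <=
   (packet_const alpha p * C0^-1 * X)%:E)%E.
Proof.
move=> eu ep opX.
have c0 := fock_const_gt0 alpha_gt0 p_gt0.
set k := packet_const alpha p / (2 ^ N.*2.+1)%:R.
have k0 : 0 <= k.
  by rewrite divr_ge0// mulr_ge0// powR_ge0.
pose g (e : {ffun 'I_(N.*2.+1) -> bool}) (xy : plane) : \bar R :=
  (k%:E * (cabs (wcomp u psi (packet alpha e) (xy.1 +i* xy.2)) `^ p *
    expR (- (alpha * p / 2) * cabs (xy.1 +i* xy.2) ^+ 2))%:E)%E.
have mh (e : {ffun 'I_(N.*2.+1) -> bool}) : measurable_fun setT (fun xy : plane =>
    (cabs (wcomp u psi (packet alpha e) (xy.1 +i* xy.2)) `^ p *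
    expR (- (alpha * p / 2) * cabs (xy.1 +i* xy.2) ^+ 2))%:E).
  apply/measurable_EFinP.
  have ew := entire_wcomp eu ep (entire_packet alpha e).
  exact: (measurable_fock_integrand alpha p ew).
have mg e : measurable_fun setT (g e) by exact: measurable_funeM.
have h0 (e : {ffun 'I_(N.*2.+1) -> bool}) (xy : plane) :
    (0 <= (cabs (wcomp u psi (packet alpha e) (xy.1 +i* xy.2)) `^ p *
    expR (- (alpha * p / 2) * cabs (xy.1 +i* xy.2) ^+ 2))%:E)%E.
  by rewrite lee_fin mulr_ge0 ?powR_ge0 ?expR_ge0.
have g0 e xy : (0 <= g e xy)%E by rewrite mule_ge0.
set S := [set xy | _].
have mS : measurable S.
  have [_ mi _] := measurable_plane_entire ep.
  have -> : S = (fun xy : plane => complex.Im (psi (xy.1 +i* xy.2))) @^-1` `[- N%:R, N%:R].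
    by apply/seteqP; split=> xy; rewrite /S/= in_itv/= ler_norml.
  by rewrite -[X in measurable X]setTI; apply: mi.
have msum : measurable_fun setT (fun xy : plane => \sum_(e : {ffun 'I_(N.*2.+1) -> bool}) g e xy)%E.
  exact: emeasurable_sum.
apply: (@le_trans _ _ (\int[plane_measure R]_(xy in S)
    \sum_(e : {ffun 'I_(N.*2.+1) -> bool}) g e xy)%E).
  apply: ge0_le_integral => //.
  - by move=> xy _; rewrite lee_fin symbol_weight_ge0.
  - apply/measurable_EFinP; apply: measurable_funS (measurable_symbol_weight alpha p eu ep) => //.
  - exact: measurable_funS msum.
  - move=> xy Sxy; rewrite /g.
    under eq_bigr do rewrite -EFinM.
    by rewrite sumEFin lee_fin; exact: symbol_weight_le_packets.
apply: (@le_trans _ _ (\int[plane_measure R]_xy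
    \sum_(e : {ffun 'I_(N.*2.+1) -> bool}) g e xy)%E).
  apply: ge0_subset_integral => //.
  by move=> xy _; apply: sume_ge0.
rewrite ge0_integral_sum//.
apply: (@le_trans _ _ (\sum_(e : {ffun 'I_(N.*2.+1) -> bool}) (k * (C0^-1 * X))%:E)%E).
  apply: lee_sum => e _; rewrite /g ge0_integralZl_EFin//.
  rewrite [leRHS]EFinM lee_wpmul2l ?lee_fin// EFinM -opX.
  exact: fock_integral_packet_le.
rewrite sumEFin lee_fin sumr_const card_ffun card_bool card_ord.
have n0 : (2 ^ N.*2.+1)%:R != 0 :> R by rewrite pnatr_eq0 -lt0n expn_gt0.
by rewrite -[leLHS]mulr_natr mulrAC /k divfK// mulrA.
Qed.

(** Monotone convergence along the strips. *)
Lemma symbol_integral_le_opnorm u psi : entire u -> entire psi ->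
  (symbol_integral alpha p u psi <=
   (packet_const alpha p * C0^-1)%:E *
   fock_opnorm alpha +oo p%:E (wcomp u psi) `^ p)%E.
Proof.
move=> eu ep.
have c0 := fock_const_gt0 alpha_gt0 p_gt0.
have K0 : 0 < packet_const alpha p * C0^-1.
  rewrite mulr_gt0 ?invr_gt0// mulr_gt0// powR_gt0// mulr_gt0 ?expR_gt0//.
  exact: packet_bound_gt0.
have := poweR_ge0 (fock_opnorm alpha +oo p%:E (wcomp u psi)) p.
case opX: (_ `^ p)%E => [X| |//] _; last by rewrite gt0_muley ?lte_fin// leey.
pose S N : set plane := [set xy | `|complex.Im (psi (xy.1 +i* xy.2))| <= N%:R].
have mS N : measurable (S N).
  have [_ mi _] := measurable_plane_entire ep.
  have -> : S N = (fun xy : plane => complex.Im (psi (xy.1 +i* xy.2))) @^-1` `[- N%:R, N%:R].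
    by apply/seteqP; split=> xy; rewrite /S/= in_itv/= ler_norml.
  by rewrite -[X in measurable X]setTI; apply: mi.
have ST : \bigcup_N S N = setT.
  rewrite -subTset => xy _; exists (Num.truncn `|complex.Im (psi (xy.1 +i* xy.2))|).+1 => //.
  by rewrite /S/= ltW// truncnS_gt.
have ndS : {homo S : n m / (n <= m)%N >-> (n <= m)%O}.
  move=> n m nm; rewrite subsetEset => xy; rewrite /S/= => /le_trans; apply.
  by rewrite ler_nat.
have mW := measurable_symbol_weight alpha p eu ep.
have mWS N : measurable_fun (S N) (fun xy : plane =>
    (symbol_weight alpha p u psi (xy.1 +i* xy.2))%:E).
  by apply/measurable_EFinP; apply: measurable_funS mW.
have W0 N (xy : plane) : S N xy -> (0 <= (symbol_weight alpha p u psi (xy.1 +i* xy.2))%:E)%E.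
  by rewrite lee_fin symbol_weight_ge0.
have cv := ge0_nondecreasing_set_cvg_integral (mu := plane_measure R) ndS mS mWS W0.
rewrite ST in cv.
rewrite /symbol_integral cintegralE -(cvg_lim (@ereal_hausdorff _) cv).
apply: lime_le; first by apply/cvg_ex; eexists; exact: cv.
by apply: nearW => N; rewrite -EFinM; exact: symbol_integral_strip_le.
Qed.

End LowerBound.

(** * Boundedness, compactness and the theorem *)

Section Equivalences.
Variables (R : realType) (alpha p : R).
Hypotheses (alpha_gt0 : 0 < alpha) (p_gt0 : 0 < p).
Implicit Types (u psi : R[i] -> R[i]).
Local Notation plane := (measurableTypeR R * measurableTypeR R)%type.
Local Notation C0 := (alpha * p / (2 * pi) : R).

Lemma ge0_cvge0P (x : nat -> \bar R) : (forall n, (0 <= x n)%E) ->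
  (x @ \oo --> 0%E) <->
  (forall e : R, 0 < e -> exists N, forall n, (N <= n)%N -> (x n <= e%:E)%E).
Proof.
move=> x0; split.
- move=> /fine_cvgP[[N1 _ fin] /cvgrPdist_le H] e e0.
  have [N2 _ HN] := H e e0.
  exists (maxn N1 N2) => n; rewrite geq_max => /andP[n1 n2].
  have := HN n n2; rewrite /= sub0r normrN => h.
  by rewrite -(fineK (fin n n1)) lee_fin (le_trans (ler_norm _) h).
- move=> H; apply/fine_cvgP; split.
    have [N HN] := H 1 ltr01; exists N => // n /= Nn.
    by rewrite ge0_fin_numE// (le_lt_trans (HN n Nn))// ltry.
  apply/cvgrPdist_le => e e0; have [N HN] := H e e0.
  exists N => // n /= Nn; rewrite sub0r normrN ger0_norm ?fine_ge0//.
  have fin : x n \is a fin_num by rewrite ge0_fin_numE// (le_lt_trans (HN n Nn))// ltry.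
  by rewrite -lee_fin fineK// HN.
Qed.

(** A substitute for the triangle inequality, valid also for [p < 1]. *)
Lemma powR_quasi_triangle (a b c : R) : 0 <= a -> 0 <= b -> 0 <= c -> c <= a + b ->
  c `^ p <= 2 `^ p * (a `^ p + b `^ p).
Proof.
move=> a0 b0 c0 cab.
have := @powR_max_le R p a b (c / 2) p_gt0 a0 b0.
rewrite divr_ge0// (_ : 2 * (c / 2) = c); last by field.
move=> /(_ isT cab) H.
have -> : c `^ p = 2 `^ p * (c / 2) `^ p.
  by rewrite -powRM ?divr_ge0// mulrC divfK.
by rewrite ler_wpM2l ?powR_ge0.
Qed.

Lemma fock_integral_quasi_triangle (f g : R[i] -> R[i]) : entire f -> entire g ->
  (fock_integral alpha p f <= (2 `^ p)%:E *
    (fock_integral alpha p (fun z => (f z - g z)%R) + fock_integral alpha p g))%E.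
Proof.
move=> ef eg.
have eh := entireB ef eg.
have mf := measurable_fock_integrand alpha p ef.
have mg := measurable_fock_integrand alpha p eg.
have mh := measurable_fock_integrand alpha p eh.
have pos (h : R[i] -> R[i]) (xy : plane) :
    (0 <= (cabs (h (xy.1 +i* xy.2)) `^ p *
      expR (- (alpha * p / 2) * cabs (xy.1 +i* xy.2) ^+ 2))%:E)%E.
  by rewrite lee_fin mulr_ge0 ?powR_ge0 ?expR_ge0.
move/measurable_EFinP in mf; move/measurable_EFinP in mg; move/measurable_EFinP in mh.
have posD (xy : plane) : setT xy ->
    (0 <= (cabs (f (xy.1 +i* xy.2) - g (xy.1 +i* xy.2)) `^ p *
      expR (- (alpha * p / 2) * cabs (xy.1 +i* xy.2) ^+ 2))%:E +
    (cabs (g (xy.1 +i* xy.2)) `^ p *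
      expR (- (alpha * p / 2) * cabs (xy.1 +i* xy.2) ^+ 2))%:E)%E.
  by move=> _; apply: adde_ge0; [exact: pos (fun z => f z - g z) xy|exact: pos].
rewrite /fock_integral !cintegralE.
rewrite -(ge0_integralD (plane_measure R) measurableT
  (fun xy _ => pos (fun z => f z - g z) xy) mh (fun xy _ => pos g xy) mg).
rewrite -(ge0_integralZl_EFin (plane_measure R) measurableT posD
  (emeasurable_funD mh mg) (powR_ge0 2 p)).
apply: ge0_le_integral => //.
- exact: (measurable_funeM _ (emeasurable_funD mh mg)).
- move=> xy _; rewrite -EFinD -EFinM lee_fin -mulrDl mulrA ler_wpM2r ?expR_ge0//.
  apply: powR_quasi_triangle; rewrite ?cabs_ge0//.
  by rewrite -[X in cabs X <= _](subrK (g (xy.1 +i* xy.2))) cabsD.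
Qed.

Lemma opnorm_le_fin u psi (M : R) :
  (forall f, fock alpha +oo f -> (fock_norm alpha +oo f <= 1)%E ->
    (fock_norm alpha p%:E (wcomp u psi f) <= M%:E)%E) ->
  (fock_opnorm alpha +oo p%:E (wcomp u psi) <= M%:E)%E.
Proof. by move=> H; apply: ge_ereal_sup => _ [f [ff f1] <-]; exact: H. Qed.

Lemma bounded_opnorm u psi : fock_bounded alpha +oo p%:E (wcomp u psi) ->
  (fock_opnorm alpha +oo p%:E (wcomp u psi) < +oo)%E.
Proof.
move=> [_ [M HM]]; apply: (@le_lt_trans _ _ `|M|%:E); last exact: ltry.
apply: opnorm_le_fin => f ff f1; apply: le_trans (HM f ff) _.
have [m mE [m0 _]] := fock_sup_bound ff.
move: f1; rewrite mE !lee_fin => m1.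
by rewrite (le_trans (ler_norm _))// normrM ler_piMr// ger0_norm.
Qed.

(** Otherwise some [f n] of the unit ball would satisfy [|uC_psi f n| > n],
    and no subsequence of the images could converge. *)
Lemma compact_opnorm u psi : entire u -> entire psi ->
  fock_compact alpha +oo p%:E (wcomp u psi) ->
  (fock_opnorm alpha +oo p%:E (wcomp u psi) < +oo)%E.
Proof.
move=> eu ep [_ comp]; apply: contrapT => /negP; rewrite -leNgt leye_eq => /eqP opy.
have /choice [f fP] : forall n : nat, exists f, [/\ fock alpha +oo f,
    (fock_norm alpha +oo f <= 1)%E &
    (n%:R%:E < fock_norm alpha p%:E (wcomp u psi f))%E].
  move=> n; apply: contrapT => H.
  have : (fock_opnorm alpha +oo p%:E (wcomp u psi) <= n%:R%:E)%E.
    apply: opnorm_le_fin => f ff f1; rewrite leNgt; apply/negP => h.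
    by apply: H; exists f; split; [exact: ff|exact: f1|exact: h].
  by rewrite opy leye_eq.
have ff n : fock alpha +oo (f n) by have [h _ _] := fP n; exact: h.
have f1 : exists M : R, forall n, (fock_norm alpha +oo (f n) <= M%:E)%E.
  by exists 1 => n; have [_ h _] := fP n; exact: h.
have [phi [g [phim [eg gfin]]]] := comp f ff f1.
move=> /ge0_cvge0P H.
have [|N HN] := H _ 1 ltr01; first by move=> n; rewrite fock_normE poweR_ge0.
have c0 := fock_const_gt0 alpha_gt0 p_gt0.
have norm_fin (h : R[i] -> R[i]) (m : R) : 0 <= m ->
    (fock_norm alpha p%:E h <= m%:E)%E ->
    (fock_integral alpha p h <= (C0^-1 * m `^ p)%:E)%E.
  move=> m0 hm.
  rewrite EFinM muleC lee_pdivlMr// muleC -fock_norm_pow// -poweR_EFin.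
  by apply: le_poweR => //; [exact: ltW|rewrite fock_normE poweR_ge0].
have g0 : (0 <= fock_norm alpha p%:E g)%E by rewrite fock_normE poweR_ge0.
pose mg := fine (fock_norm alpha p%:E g).
have mgE : fock_norm alpha p%:E g = mg%:E by rewrite fineK// ge0_fin_numE.
have mg0 : 0 <= mg by exact: fine_ge0.
have Ig := norm_fin g mg mg0 ltac:(by rewrite mgE).
pose K := C0 * (2 `^ p * (C0^-1 * 1 `^ p + C0^-1 * mg `^ p)).
have K0 : 0 <= K.
  by rewrite mulr_ge0 ?(ltW c0)// mulr_ge0 ?powR_ge0// addr_ge0// mulr_ge0 ?powR_ge0// invr_ge0 ltW.
have bound n : (N <= n)%N ->
    (fock_norm alpha p%:E (wcomp u psi (f (phi n))) <= (K `^ p^-1)%:E)%E.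
  move=> Nn; rewrite fock_normE -poweR_EFin; apply: le_poweR.
  - by rewrite invr_ge0 ltW.
  - by rewrite mule_ge0 ?fock_integral_ge0// lee_fin ltW.
  rewrite /K [leRHS]EFinM lee_wpmul2l ?lee_fin ?(ltW c0)//.
  have [[ef _] _ _] := fP (phi n).
  apply: le_trans (fock_integral_quasi_triangle (entire_wcomp eu ep ef) eg) _.
  rewrite [leRHS]EFinM lee_wpmul2l ?lee_fin ?powR_ge0// EFinD leeD//.
  exact: norm_fin (HN n Nn).
have phin n : (n <= phi n)%N.
  elim: n => // n IH; exact: leq_ltn_trans IH (phim _ _ (ltnSn n)).
pose m := maxn N (Num.truncn (K `^ p^-1)).+1.
have [_ _ big] := fP (phi m).
have := lt_le_trans big (bound m (leq_maxl _ _)).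
rewrite lte_fin; apply/negP; rewrite -leNgt.
rewrite (le_trans (ltW (truncnS_gt _)))// ler_nat (leq_trans _ (phin m))//.
exact: leq_maxr.
Qed.

Lemma symbol_integral_fin u psi : entire u -> entire psi ->
  (fock_opnorm alpha +oo p%:E (wcomp u psi) < +oo)%E ->
  (symbol_integral alpha p u psi < +oo)%E.
Proof.
move=> eu ep op; apply: le_lt_trans (symbol_integral_le_opnorm alpha_gt0 p_gt0 eu ep) _.
have c0 := fock_const_gt0 alpha_gt0 p_gt0.
apply: lte_mul_pinfty; rewrite ?poweR_lty//.
by rewrite lee_fin mulr_ge0 ?invr_ge0 ?(ltW c0)// mulr_ge0// powR_ge0.
Qed.

Lemma bounded_of_integral u psi : entire u -> entire psi ->
  (symbol_integral alpha p u psi < +oo)%E ->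
  fock_bounded alpha +oo p%:E (wcomp u psi).
Proof.
move=> eu ep Jfin.
have c0 := fock_const_gt0 alpha_gt0 p_gt0.
have J0 := symbol_integral_ge0 alpha p u psi.
pose J := fine (symbol_integral alpha p u psi).
have JE : symbol_integral alpha p u psi = J%:E by rewrite fineK// ge0_fin_numE.
have J0' : 0 <= J by exact: fine_ge0.
have main f : fock alpha +oo f -> (fock_norm alpha p%:E (wcomp u psi f) <=
    ((C0 * J) `^ p^-1)%:E * fock_norm alpha +oo f)%E.
  move=> ff; have [m -> [m0 fm]] := fock_sup_bound ff; case: ff => ef _.
  have := fock_integral_wcomp_le p_gt0 eu ep ef m0 fm; rewrite JE => H.
  rewrite fock_normE -EFinM.
  have -> : (C0 * J) `^ p^-1 * m = (C0 * (m `^ p * J)) `^ p^-1.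
    have CJ0 : 0 <= C0 * J by exact: (mulr_ge0 (ltW c0)).
    rewrite (mulrCA C0) [RHS]powRM ?powR_ge0//.
    by rewrite -powRrM mulfV ?gt_eqF// powRr1// mulrC.
    rewrite -poweR_EFin; apply: le_poweR.
  - by rewrite invr_ge0 ltW.
  - by rewrite mule_ge0 ?fock_integral_ge0// lee_fin ltW.
  by rewrite [leRHS]EFinM lee_wpmul2l ?lee_fin ?(ltW c0).
split; last by exists ((C0 * J) `^ p^-1).
move=> f ff; split.
  by case: ff => ef _; exact: entire_wcomp.
apply: le_lt_trans (main f ff) _.
by have [m -> _] := fock_sup_bound ff; rewrite -EFinM ltry.
Qed.

(** Along the subsequence of [montel] the integrands of the norms tend to zero,
    and they are dominated by a multiple of [symbol_weight]. *)
Lemma compact_of_integral u psi : entire u -> entire psi ->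
  (symbol_integral alpha p u psi < +oo)%E ->
  fock_compact alpha +oo p%:E (wcomp u psi).
Proof.
move=> eu ep Jfin.
have [maps _] := bounded_of_integral eu ep Jfin.
have c0 := fock_const_gt0 alpha_gt0 p_gt0.
split; first exact: maps.
move=> f ff [M fM].
have fM' n := (fock_norm_sup_le alpha (f n) M).1 (fM n).
have M0 : 0 <= M by rewrite -lee_fin (le_trans (fock_norm_sup_ge0 alpha (f 0%N))).
pose B r := M * expR (alpha / 2 * r ^+ 2).
have fB n z r : cabs z <= r -> cabs (f n z) <= B r.
  move=> zr; apply: le_trans (fM' n z) _.
  have z0 := cabs_ge0 z.
  rewrite ler_wpM2l// ler_expR ler_wpM2l ?divr_ge0 ?(ltW alpha_gt0)//.
  by rewrite ler_pXn2r// ?nnegrE// (le_trans z0).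
have [phi [g [phim eg cg]]] := montel (fun n => (ff n).1) fB.
have gM z : cabs (g z) <= M * expR (alpha / 2 * cabs z ^+ 2).
  apply/ler_addgt0Pr => e e0; have [N HN] := cg z e e0.
  rewrite -(subKr (f (phi N) z) (g z)) (le_trans (cabsB _ _))// lerD//.
  exact: HN.
have fg : fock alpha +oo g.
  split; first exact: eg.
  by apply: (@le_lt_trans _ _ M%:E); [apply/fock_norm_sup_le; exact: gM|exact: ltry].
exists phi, (wcomp u psi g); split; [exact: phim|exact: maps|].
pose h n z := f (phi n) z - g z.
have eh n : entire (h n) by exact: (entireB (ff (phi n)).1 eg).
have hM n z : cabs (h n z) <= (2 * M) * expR (alpha / 2 * cabs z ^+ 2).
  apply: le_trans (cabsB _ _) _.
  rewrite [leRHS](_ : _ = M * expR (alpha / 2 * cabs z ^+ 2) +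
    M * expR (alpha / 2 * cabs z ^+ 2)); last by ring.
  by apply: lerD; [exact: fM'|exact: gM].
have hE n : (fun z => wcomp u psi (f (phi n)) z - wcomp u psi g z) = wcomp u psi (h n).
  by apply/funext => z; rewrite /wcomp /h mulrBr.
have -> : (fun n => fock_norm alpha p%:E
    (fun z => wcomp u psi (f (phi n)) z - wcomp u psi g z)) =
    (fun n => fock_norm alpha p%:E (wcomp u psi (h n))).
  by apply/funext => n; rewrite hE.
pose F n (xy : plane) : \bar R := (cabs (wcomp u psi (h n) (xy.1 +i* xy.2)) `^ p *
    expR (- (alpha * p / 2) * cabs (xy.1 +i* xy.2) ^+ 2))%:E.
pose G (xy : plane) : \bar R :=
  (((2 * M) `^ p)%:E * (symbol_weight alpha p u psi (xy.1 +i* xy.2))%:E)%E.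
have mF n : measurable_fun setT (F n).
  have hf := measurable_fock_integrand alpha p (entire_wcomp eu ep (eh n)).
  by apply/measurable_EFinP; exact: hf.
have F0 n xy : (0 <= F n xy)%E by rewrite lee_fin mulr_ge0 ?powR_ge0 ?expR_ge0.
have mWE : measurable_fun setT
    (fun xy : plane => (symbol_weight alpha p u psi (xy.1 +i* xy.2))%:E).
  by apply/measurable_EFinP; exact: (measurable_symbol_weight alpha p eu ep).
have iW : (plane_measure R).-integrable setT
    (fun xy : plane => (symbol_weight alpha p u psi (xy.1 +i* xy.2))%:E).
  apply/integrableP; split; first exact: mWE.
  rewrite (eq_integral (fun xy : plane => (symbol_weight alpha p u psi (xy.1 +i* xy.2))%:E)).
    exact: Jfin.
  by move=> xy _; rewrite gee0_abs// lee_fin symbol_weight_ge0.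
have iG : (plane_measure R).-integrable setT G by exact: integrableZl.
have FG n xy : (F n xy <= G xy)%E.
  by rewrite /F /G -EFinM lee_fin; apply: wcomp_integrand_le; rewrite ?mulr_ge0.
have Fcv xy : F n xy @[n --> \oo] --> 0%E.
  apply/ge0_cvge0P => // e e0.
  pose z : R[i] := xy.1 +i* xy.2.
  have d0 : 0 < e `^ p^-1 by rewrite powR_gt0.
  have K1 : 0 < 1 + cabs (u z) by rewrite ltr_wpDr ?cabs_ge0.
  have [N HN] := cg (psi z) _ (divr_gt0 d0 K1).
  exists N => n Nn; rewrite /F -/z lee_fin.
  have small : cabs (wcomp u psi (h n) z) <= e `^ p^-1.
    rewrite /wcomp cabsM (le_trans (ler_wpM2l (cabs_ge0 _) (HN n Nn)))//.
    rewrite mulrA ler_pdivrMr// mulrC ler_wpM2l ?(ltW d0)//.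
    by rewrite lerDr.
  have smallp : cabs (wcomp u psi (h n) z) `^ p <= e.
    have -> : e = (e `^ p^-1) `^ p by rewrite -powRrM mulVf ?gt_eqF// powRr1// ltW.
    by rewrite ge0_ler_powR ?nnegrE ?cabs_ge0 ?(ltW p_gt0) ?(ltW d0).
  apply: le_trans smallp; rewrite ler_piMr ?powR_ge0//.
  rewrite -expR0 ler_expR mulNr oppr_le0 mulr_ge0 ?sqr_ge0//.
  by rewrite divr_ge0// mulr_ge0// ltW.
have [] := @dominated_convergence _ _ R (plane_measure R) setT measurableT F (cst 0%E) G.
- exact: mF.
- exact: measurable_cst.
- by apply: aeW => xy _; exact: Fcv.
- exact: iG.
- by apply: aeW => xy n _; rewrite gee0_abs//; exact: FG.
move=> _ _; rewrite integral0 => lim.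
have I0 n : (0 <= fock_integral alpha p (wcomp u psi (h n)))%E by exact: fock_integral_ge0.
have {}lim : (fun n => fock_integral alpha p (wcomp u psi (h n))) @ \oo --> 0%E by exact: lim.
apply/ge0_cvge0P; first by move=> n; rewrite fock_normE poweR_ge0.
move=> e e0.
have /(ge0_cvge0P I0) H := lim.
have d0 : 0 < C0^-1 * e `^ p by rewrite mulr_gt0 ?powR_gt0// invr_gt0.
have [N HN] := H _ d0.
exists N => n Nn.
have -> : e = (e `^ p) `^ p^-1 by rewrite -powRrM mulfV ?gt_eqF// powRr1// ltW.
rewrite fock_normE -poweR_EFin; apply: le_poweR.
- by rewrite invr_ge0 ltW.
- by rewrite mule_ge0// lee_fin ltW.
have -> : e `^ p = C0 * (C0^-1 * e `^ p) by rewrite mulVKf ?gt_eqF.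
by rewrite [leRHS]EFinM lee_wpmul2l ?lee_fin ?(ltW c0)// HN.
Qed.

End Equivalences.

Theorem corollary3p1 (R : realType) (alpha p : R)
    (alpha_gt0 : 0 < alpha) (p_gt0 : 0 < p) :
  (forall psi u : R[i] -> R[i], entire psi -> entire u ->
    [/\ fock_bounded alpha +oo%E p%:E (wcomp u psi) <->
          fock_compact alpha +oo%E p%:E (wcomp u psi) &
        fock_compact alpha +oo%E p%:E (wcomp u psi) <->
          (kernel_integral alpha p u psi < +oo)%E]) /\
  (exists C : R, 0 < C /\
    forall psi u : R[i] -> R[i], entire psi -> entire u ->
      fock_bounded alpha +oo%E p%:E (wcomp u psi) ->
      [/\ ((C^-1)%:E * kernel_integral alpha p u psi <=
             fock_opnorm alpha +oo%E p%:E (wcomp u psi) `^ p)%E,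
          (fock_opnorm alpha +oo%E p%:E (wcomp u psi) `^ p <=
             C%:E * kernel_integral alpha p u psi)%E &
          (kernel_integral alpha p u psi < +oo)%E]).
Proof.
have [K K0 KE] := kernel_integralE alpha_gt0 p_gt0.
have c0 := fock_const_gt0 alpha_gt0 p_gt0.
have fin psi u : entire psi -> entire u -> (kernel_integral alpha p u psi < +oo)%E <->
    (symbol_integral alpha p u psi < +oo)%E.
  move=> ep eu; rewrite (KE u psi eu ep); split=> H.
    rewrite ltNge; apply/negP; rewrite leye_eq => /eqP E.
    by move: H; rewrite E gt0_muley ?lte_fin// ltxx.
  by apply: lte_mul_pinfty => //; rewrite lee_fin ltW.
split.
  move=> psi u ep eu; rewrite (fin psi u ep eu).
  split; split=> H.
  - apply: (compact_of_integral alpha_gt0 p_gt0 eu ep).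
    exact: (symbol_integral_fin alpha_gt0 p_gt0 eu ep (bounded_opnorm H)).
  - apply: (bounded_of_integral alpha_gt0 p_gt0 eu ep).
    exact: (symbol_integral_fin alpha_gt0 p_gt0 eu ep (compact_opnorm alpha_gt0 p_gt0 eu ep H)).
  - exact: (symbol_integral_fin alpha_gt0 p_gt0 eu ep (compact_opnorm alpha_gt0 p_gt0 eu ep H)).
  - exact: (compact_of_integral alpha_gt0 p_gt0 eu ep H).
set D := alpha * p / (2 * pi) in c0.
set L := packet_const alpha p * D^-1.
have L0 : 0 < L.
  rewrite mulr_gt0 ?invr_gt0// mulr_gt0// powR_gt0// mulr_gt0 ?expR_gt0//.
  exact: packet_bound_gt0.
have C0 : 0 < K * L + D / K by apply: addr_gt0; [exact: mulr_gt0|exact: divr_gt0].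
exists (K * L + D / K); split=> // psi u ep eu bd.
have Jfin := symbol_integral_fin alpha_gt0 p_gt0 eu ep (bounded_opnorm bd).
have J0 := symbol_integral_ge0 alpha p u psi.
have up := opnorm_pow_le alpha_gt0 p_gt0 eu ep.
have lo := symbol_integral_le_opnorm alpha_gt0 p_gt0 eu ep.
have op0 := poweR_ge0 (fock_opnorm alpha +oo p%:E (wcomp u psi)) p.
split; last exact: (fin psi u ep eu).2 Jfin.
- rewrite muleC lee_pdivrMr// (KE u psi eu ep).
  apply: (@le_trans _ _ (K%:E * (L%:E * fock_opnorm alpha +oo p%:E (wcomp u psi) `^ p))%E).
    by rewrite lee_wpmul2l ?lee_fin ?(ltW K0).
  rewrite muleA -EFinM muleC lee_wpmul2l// lee_fin lerDl.
  exact/ltW/divr_gt0.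
- rewrite (KE u psi eu ep) muleA -EFinM.
  apply: le_trans up _; rewrite lee_wpmul2r// lee_fin -/D mulrDl divfK ?gt_eqF//.
  by rewrite lerDr; apply: mulr_ge0; [exact/ltW/mulr_gt0|exact: ltW].
Qed.
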